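(* Let $(M^{2m},\varphi,g)$ be a locally symmetric para-Kähler-Norden manifold, let $T^{\varphi}_{1}M$ be its $\varphi$-unit tangent bundle equipped with the $\varphi$-Sasaki metric, and let $\Gamma$ be a naturally parameterized non-vertical geodesic on $T^{\varphi}_{1}M$. Then all Frenet curvatures of the projected curve $\gamma=\pi\circ\Gamma$ are constant.
   Context: A para-Kähler-Norden manifold $(M^{2m},\varphi,g)$ is a $2m$-dimensional Riemannian manifold $(M,g)$ with a $(1,1)$-tensor field $\varphi$ such that $\varphi^2=\mathrm{id}$, $\varphi\ne\pm\mathrm{id}$, the $+1$ and $-1$ eigenbundles of $\varphi$ have equal rank, $g(\varphi X,Y)=g(X,\varphi Y)$, and $\nabla\varphi=0$, where $\nabla$ is the Levi-Civita connection of $g$. Locally symmetric means $\nabla R=0$, $R$ being the curvature tensor of $g$. $\pi:TM\to M$ is the natural projection and $|\cdot|$ the norm of $g$. Points of $TM$ are written $(x,\xi)$; ${}^{H}X$, ${}^{V}X$ are the horizontal (with respect to $\nabla$) and vertical lifts to $TM$. The $\varphi$-Sasaki metric $g^\varphi$ on $TM$ is defined by $g^\varphi({}^HX,{}^HY)=g(X,Y)$, $g^\varphi({}^HX,{}^VY)=0$, $g^\varphi({}^VX,{}^VY)=g(X,\varphi Y)$. The $\varphi$-unit tangent bundle is the hypersurface $T^{\varphi}_{1}M=\{(x,\xi)\in TM: g(\xi,\varphi\xi)=1\}$, equipped with the metric induced by $g^\varphi$; $\widehat\nabla$ is the Levi-Civita connection of this induced metric. A curve $\Gamma=(\gamma(t),\xi(t))$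 consists of a curve $\gamma$ on $M$ and a vector field $\xi$ along $\gamma$. Write $\gamma_t'=d\gamma/dt$ and $\xi_t'=\nabla_{\gamma_t'}\xi$; then $\Gamma_t'={}^H\gamma_t'+{}^V\xi_t'$. $\Gamma$ is naturally parameterized if $t$ is an arc length parameter, i.e. $g^\varphi(\Gamma_t',\Gamma_t')=|\gamma_t'|^2+g(\xi_t',\varphi\xi_t')=1$. $\Gamma$ is a geodesic on $T^\varphi_1M$ if $\widehat\nabla_{\Gamma_t'}\Gamma_t'=0$. A geodesic is vertical if $|\gamma_t'|=0$ (so $\gamma$ is a constant point), and non-vertical otherwise. Frenet curvatures $k_1,\dots,k_{2m-1}$ of $\gamma$: with $s$ an arc length parameter on $\gamma$ and Frenet frame $\nu_1=\gamma_s',\nu_2,\dots$ (orthonormal), $(\nu_1)_s'=k_1\nu_2$, $(\nu_i)_s'=-k_{i-1}\nu_{i-1}+k_i\nu_{i+1}$ for intermediate $i$, and the derivative of the last frame vector $\nu_{2m}$ is $-k_{2m-1}\nu_{2m-1}$; if some $k_i$ vanishes identically, the process stops there and the later curvatures are taken to be $0$. *)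

(* Defs.v *)
From HB Require Import structures.
From mathcomp Require Import all_boot all_order all_algebra.
From mathcomp Require Import all_classical all_reals all_analysis.
From mathcomp Require Import lra.

Set Implicit Arguments.
Unset Strict Implicit.
Unset Printing Implicit Defensive.

Import Order.TTheory GRing.Theory Num.Theory.
Import numFieldNormedType.Exports.

Local Open Scope classical_set_scope.
Local Open Scope ring_scope.

(* Tangent vectors are row vectors of components; an endomorphism with matrix
   F maps v to v *m F, and a bilinear form with matrix G maps (u, v) to
   u *m G *m v^T, so F i k is F_i^k and G i j is G_ij. *)

Definition partial (R : realType) (n : nat) (V : normedModType R)
    (i : 'I_n) (f : 'rV[R]_n -> V) (x : 'rV[R]_n) : V :=
  'D_(delta_mx 0 i) f x.

Definition partials (R : realType) (n : nat) (V : normedModType R)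
    (l : seq 'I_n) (f : 'rV[R]_n -> V) : 'rV[R]_n -> V :=
  foldr (fun i h => partial i h) f l.

Definition smooth_on (R : realType) (n : nat) (V : normedModType R)
    (U : set 'rV[R]_n) (f : 'rV[R]_n -> V) : Prop :=
  forall (l : seq 'I_n) (x : 'rV[R]_n), U x -> differentiable (partials l f) x.

Definition smooth_curve_on (R : realType) (V : normedModType R)
    (I : set R) (f : R -> V) : Prop :=
  forall (k : nat) (t : R), I t -> derivable (derive1n k f) t 1.

Definition dot (R : realType) (n : nat) (G : 'M[R]_n) (u v : 'rV[R]_n) : R :=
  (u *m G *m v^T) 0 0.

Section coordinates.
Variables (R : realType) (n : nat).
Implicit Types (G F : 'rV[R]_n -> 'M[R]_n) (x : 'rV[R]_n) (z a b : 'rV[R]_(n + n)).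

(* The symbol Gamma_ij^k of the Levi-Civita connection of the
   pseudo-Riemannian metric with components G; see christoffelC and
   christoffel_metric below. *)
Definition christoffel G x (i j k : 'I_n) : R :=
  2^-1 * \sum_l (partial i (fun y => G y j l) x + partial j (fun y => G y i l) x
                 - partial l (fun y => G y i j) x) * invmx (G x) l k.

Definition christoffel_app G x (u v : 'rV[R]_n) : 'rV[R]_n :=
  \row_k \sum_i \sum_j u 0 i * v 0 j * christoffel G x i j k.

(* The covariant derivative of V along the curve c. *)
Definition cov_along G (c V : R -> 'rV[R]_n) (t : R) : 'rV[R]_n :=
  derive1 V t + christoffel_app G (c t) (derive1 c t) (V t).

(* (nabla_i F)_j^k *)
Definition cov_endo G F x (i j k : 'I_n) : R :=
  partial i (fun y => F y j k) x
  + \sum_l F x j l * christoffel G x i l k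
  - \sum_l christoffel G x i j l * F x l k.

(* R(d_i, d_j) d_k = sum_l (riemann G x i j k l) d_l *)
Definition riemann G x (i j k l : 'I_n) : R :=
  partial i (fun y => christoffel G y j k l) x
  - partial j (fun y => christoffel G y i k l) x
  + \sum_p christoffel G x j k p * christoffel G x i p l
  - \sum_p christoffel G x i k p * christoffel G x j p l.

(* (nabla_p R)_ijk^l *)
Definition cov_riemann G x (p i j k l : 'I_n) : R :=
  partial p (fun y => riemann G y i j k l) x
  - \sum_q christoffel G x p i q * riemann G x q j k l
  - \sum_q christoffel G x p j q * riemann G x i q k l
  - \sum_q christoffel G x p k q * riemann G x i j q l
  + \sum_q christoffel G x p q l * riemann G x i j k q.

(* Over a chart, the point (x, xi) of TM is z = row_mx x xi, and a tangent
   vector to TM at z is likewise a row vector of length n + n. *)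
Definition hlift G z (u : 'rV[R]_n) : 'rV[R]_(n + n) :=
  row_mx u (- christoffel_app G (lsubmx z) u (rsubmx z)).

Definition vlift (u : 'rV[R]_n) : 'rV[R]_(n + n) := row_mx 0 u.

Definition hpart a : 'rV[R]_n := lsubmx a.

Definition vpart G z a : 'rV[R]_n :=
  rsubmx a + christoffel_app G (lsubmx z) (lsubmx a) (rsubmx z).

(* The phi-Sasaki metric; see hvlift_decomposition and the lemmas sasaki_hh,
   sasaki_hv, sasaki_vv. *)
Definition sasaki G F z a b : R :=
  dot (G (lsubmx z)) (hpart a) (hpart b)
  + dot (G (lsubmx z)) (vpart G z a) (vpart G z b *m F (lsubmx z)).

Lemma hvlift_decomposition G z a : a = hlift G z (hpart a) + vlift (vpart G z a).
Proof.
rewrite /hlift /vlift /hpart /vpart add_row_mx addr0 [X in row_mx _ X]addrC addrK.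
by rewrite hsubmxK.
Qed.

Let hpart_hlift G z u : hpart (hlift G z u) = u.
Proof. by rewrite /hpart /hlift row_mxKl. Qed.

Let hpart_vlift u : hpart (vlift u) = 0.
Proof. by rewrite /hpart /vlift row_mxKl. Qed.

Let vpart_hlift G z u : vpart G z (hlift G z u) = 0.
Proof. by rewrite /vpart /hlift row_mxKl row_mxKr addNr. Qed.

Let vpart_vlift G z u : vpart G z (vlift u) = u.
Proof.
rewrite /vpart /vlift row_mxKl row_mxKr /christoffel_app.
rewrite [X in _ + X](_ : _ = 0) ?addr0//; apply/rowP => k; rewrite !mxE.
by rewrite big1 // => i _; rewrite big1 // => j _; rewrite mxE !mul0r.
Qed.

Let dot0l (A : 'M[R]_n) v : dot A 0 v = 0.
Proof. by rewrite /dot !mul0mx mxE. Qed.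

Let dot0r (A : 'M[R]_n) u : dot A u 0 = 0.
Proof. by rewrite /dot trmx0 mulmx0 mxE. Qed.

Lemma sasaki_hh G F z u v :
  sasaki G F z (hlift G z u) (hlift G z v) = dot (G (lsubmx z)) u v.
Proof. by rewrite /sasaki !hpart_hlift !vpart_hlift dot0l addr0. Qed.

Lemma sasaki_hv G F z u v : sasaki G F z (hlift G z u) (vlift v) = 0.
Proof. by rewrite /sasaki hpart_vlift vpart_hlift dot0l dot0r addr0. Qed.

Lemma sasaki_vv G F z u v :
  sasaki G F z (vlift u) (vlift v) = dot (G (lsubmx z)) u (v *m F (lsubmx z)).
Proof. by rewrite /sasaki !hpart_vlift !vpart_vlift dot0l add0r. Qed.

Let partial_sym G x (k i j : 'I_n) : (\forall y \near x, (G y)^T = G y) ->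
  partial k (fun y => G y i j) x = partial k (fun y => G y j i) x.
Proof.
move=> Gs; rewrite /partial; apply: near_eq_derive.
by apply: filterS Gs => y /matrixP/(_ j i); rewrite mxE.
Qed.

Lemma christoffelC G x i j k : (\forall y \near x, (G y)^T = G y) ->
  christoffel G x i j k = christoffel G x j i k.
Proof.
move=> Gs; rewrite /christoffel; congr (_ * _); apply: eq_bigr => l _.
by rewrite (partial_sym l i j Gs) (addrC (partial i _ _)).
Qed.

Lemma christoffel_metric G x i j k :
  (\forall y \near x, (G y)^T = G y) -> G x \in unitmx ->
  partial k (fun y => G y i j) x =
    \sum_l christoffel G x k i l * G x l j
    + \sum_l christoffel G x k j l * G x i l.
Proof.
move=> Gs Gu.
have lower (p q d : 'I_n) : \sum_l christoffel G x p q l * G x l d = 2^-1 *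
    (partial p (fun y => G y q d) x + partial q (fun y => G y p d) x
     - partial d (fun y => G y p q) x).
  rewrite /christoffel.
  under eq_bigr do rewrite -mulrA mulr_suml.
  rewrite -mulr_sumr exchange_big /=; congr (_ * _).
  under eq_bigr do (under eq_bigr do rewrite -mulrA; rewrite -mulr_sumr).
  have inv e : \sum_l invmx (G x) e l * G x l d = (e == d)%:R.
    by have /matrixP/(_ e d) := mulVmx Gu; rewrite !mxE.
  under eq_bigr do rewrite inv.
  by rewrite (bigD1 d)//= eqxx mulr1 big1 ?addr0// => e /negbTE->; rewrite mulr0.
have Gx : (G x)^T = G x by apply: nbhs_singleton Gs.
under [X in _ + X]eq_bigr do rewrite -Gx mxE.
rewrite !lower -mulrDr (partial_sym k j i Gs) (partial_sym j k i Gs).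
rewrite (partial_sym i k j Gs).
set p := partial k _ x; set q := partial i _ x; set s := partial j _ x.
rewrite (_ : _ + _ = 2 * p); first by rewrite mulrA mulVf ?mul1r ?pnatr_eq0.
by rewrite mulr_natl mulr2n; lra.
Qed.

End coordinates.

Record chart (R : realType) (n : nat) (M : topologicalType) := Chart {
  chart_dom : set M;
  chart_map : M -> 'rV[R]_n;
  chart_inv : 'rV[R]_n -> M }.

Section manifold.
Variables (R : realType) (n : nat) (M : topologicalType).

Implicit Types (c d : chart R n M) (A : set (chart R n M)) (I : set R).

Definition chart_img c : set 'rV[R]_n := chart_map c @` chart_dom c.

Definition is_chart c : Prop :=
  [/\ open (chart_dom c), open (chart_img c),
      {in chart_dom c, cancel (chart_map c) (chart_inv c)},
      {within chart_dom c, continuous (chart_map c)} &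
      {within chart_img c, continuous (chart_inv c)}].

Definition transition c d : 'rV[R]_n -> 'rV[R]_n := chart_map d \o chart_inv c.

Definition smooth_manifold A : Prop :=
  [/\ hausdorff_space M, @second_countable M,
      forall c, A c -> is_chart c,
      forall x : M, exists2 c, A c & chart_dom c x &
      forall c d, A c -> A d ->
        smooth_on (chart_map c @` (chart_dom c `&` chart_dom d)) (transition c d)].

(* A vector with components v in the chart c has components
   v *m change c d x in the chart d. *)
Definition change c d (x : M) : 'M[R]_n := jacobian (transition c d) (chart_map c x).

(* Tensor fields of types (0,2) and (1,1), given in each chart of the atlas by
   their components as functions of the coordinates. *)
Definition components := chart R n M -> 'rV[R]_n -> 'M[R]_n.

Implicit Types g phi : components.

Definition smooth_components A (T : components) : Prop :=
  forall c, A c -> smooth_on (chart_img c) (T c).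

Definition riemannian_metric A g : Prop :=
  [/\ smooth_components A g,
      forall c d x, A c -> A d -> chart_dom c x -> chart_dom d x ->
        g c (chart_map c x) =
          change c d x *m g d (chart_map d x) *m (change c d x)^T &
      forall c p, A c -> chart_img c p ->
        (g c p)^T = g c p /\ forall v, v != 0 -> 0 < dot (g c p) v v].

Definition endomorphism_field A phi : Prop :=
  smooth_components A phi /\
  forall c d x, A c -> A d -> chart_dom c x -> chart_dom d x ->
    phi c (chart_map c x) *m change c d x = change c d x *m phi d (chart_map d x).

Definition para_kahler_norden A g phi : Prop :=
  [/\ smooth_manifold A, riemannian_metric A g, endomorphism_field A phi,
      ~ (forall c p, A c -> chart_img c p -> phi c p = 1%:M) /\
      ~ (forall c p, A c -> chart_img c p -> phi c p = (-1)%:M) &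
      forall c p, A c -> chart_img c p ->
        [/\ phi c p *m phi c p = 1%:M,
            \rank (eigenspace (phi c p) 1) = \rank (eigenspace (phi c p) (-1)),
            forall u v, dot (g c p) (u *m phi c p) v = dot (g c p) u (v *m phi c p) &
            forall i j k, cov_endo (g c) (phi c) p i j k = 0]].

Definition locally_symmetric A g : Prop :=
  forall c p, A c -> chart_img c p ->
    forall q i j k l, cov_riemann (g c) p q i j k l = 0.

Definition coords c (gamma : R -> M) : R -> 'rV[R]_n := chart_map c \o gamma.

Definition smooth_curve A I (gamma : R -> M) : Prop :=
  (forall t, I t -> {for t, continuous gamma}) /\
  forall c, A c -> smooth_curve_on (I `&` gamma @^-1` chart_dom c) (coords c gamma).

(* A vector field along a curve, by its components in each chart. *)
Definition fieldtype := chart R n M -> R -> 'rV[R]_n.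

Implicit Types (gamma : R -> M) (X Y xi : fieldtype).

Definition field_along A I gamma X : Prop :=
  (forall c, A c -> smooth_curve_on (I `&` gamma @^-1` chart_dom c) (X c)) /\
  forall c d t, A c -> A d -> I t -> chart_dom c (gamma t) -> chart_dom d (gamma t) ->
    X d t = X c t *m change c d (gamma t).

Definition velocity gamma : fieldtype := fun c t => derive1 (coords c gamma) t.

Definition covd g gamma X : fieldtype :=
  fun c t => cov_along (g c) (coords c gamma) (X c) t.

Definition inner g gamma X Y c (t : R) : R :=
  dot (g c (coords c gamma t)) (X c t) (Y c t).

Definition phi_app phi gamma X : fieldtype :=
  fun c t => X c t *m phi c (coords c gamma t).

Definition speed g gamma c (t : R) : R :=
  Num.sqrt (inner g gamma (velocity gamma) (velocity gamma) c t).

Definition everywhere A I gamma (P : chart R n M -> R -> Prop) : Prop :=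
  forall c t, A c -> I t -> chart_dom c (gamma t) -> P c t.

Definition curve_in_T1 A g phi I gamma xi : Prop :=
  [/\ smooth_curve A I gamma, field_along A I gamma xi &
      everywhere A I gamma
        (fun c t => inner g gamma xi (phi_app phi gamma xi) c t = 1)].

(* A local parametrization, over the chart c, of the phi-unit tangent bundle:
   an injective immersion of an open set of dimension 2n - 1. *)
Definition T1_param g phi c (U : set 'rV[R]_(n + n).-1)
    (P : 'rV[R]_(n + n).-1 -> 'rV[R]_(n + n)) : Prop :=
  [/\ open U, smooth_on U P, {in U &, injective P},
      forall u, U u -> row_free (jacobian P u) &
      forall u, U u -> let x := lsubmx (P u) in let v := rsubmx (P u) in
        chart_img c x /\ dot (g c x) v (v *m phi c x) = 1].

Definition induced_metric g phi c (P : 'rV[R]_(n + n).-1 -> 'rV[R]_(n + n)) :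
    'rV[R]_(n + n).-1 -> 'M[R]_((n + n).-1) :=
  fun u => \matrix_(a, b)
    sasaki (g c) (phi c) (P u) (row a (jacobian P u)) (row b (jacobian P u)).

(* Near each time the curve (gamma, xi) is P o u for some local parametrization
   P, and the covariant derivative of u' along u vanishes for the Levi-Civita
   connection of the induced metric. *)
Definition geodesic_T1 A g phi I gamma xi : Prop :=
  curve_in_T1 A g phi I gamma xi /\
  forall t0, I t0 -> exists (c : chart R n M) (J : set R)
      (U : set 'rV[R]_(n + n).-1) (P : 'rV[R]_(n + n).-1 -> 'rV[R]_(n + n))
      (u : R -> 'rV[R]_(n + n).-1),
    [/\ A c, open J /\ J t0, T1_param g phi c U P, smooth_curve_on J u &
        forall t, J t ->
          [/\ I t, chart_dom c (gamma t), U (u t),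
              P (u t) = row_mx (coords c gamma t) (xi c t) &
              cov_along (induced_metric g phi c P) u (derive1 u) t = 0]].

Definition naturally_parameterized A g phi I gamma xi : Prop :=
  everywhere A I gamma (fun c t =>
    speed g gamma c t ^+ 2
    + inner g gamma (covd g gamma xi) (phi_app phi gamma (covd g gamma xi)) c t = 1).

Definition vertical A g I gamma : Prop :=
  everywhere A I gamma (fun c t => speed g gamma c t = 0).

(* Frenet frame nu 1, ..., nu r and curvatures k 1, ..., k (n - 1) of gamma,
   where k r is the first curvature that vanishes identically, or r = n.  With
   respect to an arc length parameter s of gamma, the derivative of a field is
   (covd X)_s = |gamma'|^-1 (covd X)_t, since ds/dt = |gamma'|. *)
Definition frenet A g I gamma (r : nat) (nu : nat -> fieldtype)
    (k : nat -> R -> R) : Prop :=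
  [/\ (0 < r <= n)%N,
      everywhere A I gamma (fun c t => speed g gamma c t != 0),
      forall i, (0 < i <= r)%N -> field_along A I gamma (nu i),
      (forall i, (0 < i < r)%N -> exists2 t, I t & k i t != 0) /\
      (forall i t, (r <= i < n)%N -> I t -> k i t = 0) &
      everywhere A I gamma (fun c t =>
        [/\ forall i j, (0 < i <= r)%N -> (0 < j <= r)%N ->
              inner g gamma (nu i) (nu j) c t = (i == j)%:R,
            nu 1%N c t = (speed g gamma c t)^-1 *: velocity gamma c t &
            forall i, (0 < i <= r)%N ->
              (speed g gamma c t)^-1 *: covd g gamma (nu i) c t =
                (if (1 < i)%N then - k i.-1 t *: nu i.-1 c t else 0)
                + (if (i < r)%N then k i t *: nu i.+1 c t else 0)])].

End manifold.

(* Main.v *)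
Require Import Defs.
From HB Require Import structures.
From mathcomp Require Import all_boot all_order all_algebra.
From mathcomp Require Import all_classical all_reals all_analysis.
From mathcomp Require Import ring lra.

Set Implicit Arguments.
Unset Strict Implicit.
Unset Printing Implicit Defensive.

Import Order.TTheory GRing.Theory Num.Theory.
Import numFieldNormedType.Exports.

Local Open Scope classical_set_scope.
Local Open Scope ring_scope.

(* Let x be the projected curve and v the vector field of the geodesic, D the
   covariant derivative along x.  Criticality for the energy under variations
   inside T1, whose tangent spaces are the g^phi-orthogonal complements of the
   vertical lifts of v, gives D D v = l v and D x' = Q x' with
   Q = R(D v, phi v).  Since R and phi are parallel and R(X, phi X) = 0, the
   endomorphism Q is parallel: D Q = l R(v, phi v) + R(D v, phi D v) = 0; it is
   also skew.  Hence fields X along x with D X = Q X form a space containing x',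
   stable under D, on which inner products are constant in time and D is skew.
   The Frenet process is Gram-Schmidt orthogonalization inside this space, so
   its coefficients are constant. *)

(** * Differential calculus *)

(** The geodesic condition is given only through local parametrizations, so [Q] exists only near
    each time and in one chart. Fields with D X = Q X are therefore tested against every local [Q],
    and constancy spreads over the whole time interval through inner products, which do not depend
    on the chart. The metric induced by g^phi is indefinite, so the connection is developed for
    nondegenerate metrics and applied both to [g] and to the induced metric. The Christoffel symbols
    of the latter are never computed: differentiating the same products once through the lifts and
    once through the induced connection yields the first variation. R(X, phi X) = 0 because R(phi X,
    Y) = R(X, phi Y) while R is antisymmetric. Since inner products in the final space are constant,
    a curvature that vanishes at one time vanishes identically; the Frenet process cannot degenerate
    at isolated times, and a frame exists on the whole interval. *)

Section Calculus.
Context {R : realType}.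
Implicit Types V W : normedModType R.

Lemma near_eq_differentiable V W (f h : V -> W) x :
  {near x, f =1 h} -> differentiable f x -> differentiable h x.
Proof.
move=> fh df.
(* The first order expansion of [f] at [x] is also one of [h], so uniqueness identifies the
   differential of [h] with that of [f]. *)
have hx : h \o shift x = cst (h x) + 'd f x +o_ 0 id.
  apply/eqaddoP => _ /posnumP[e].
  have /diff_locally/eqaddoP/(_ e%:num (ltac:(by []))) := df.
  have : \forall y \near 0, f (y + x) = h (y + x).
    by move: fh; rewrite (near_shift 0) subr0.
  apply: filterS2 => y /= e1 e2; move: e2.
  by rewrite -![(_ + _ : _ -> _) _]/(_ + _) /= -![(- _ : _ -> _) _]/(- _) /= /cst e1 (nbhs_singleton fh).
have /(diff_unique (diff_continuous df)) dh := hx.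
by apply/diff_locallyP; rewrite dh; split => //; exact: diff_continuous.
Qed.

Lemma is_derive_line V W (f : V -> W) x v (s : R) df :
  is_derive (s *: v + x) v f df <-> is_derive s 1 (fun h : R => f (h *: v + x)) df.
Proof.
have E : (fun h : R => h^-1 *: (((fun h : R => f (h *: v + x)) \o shift s) (h *: 1)
                                - f (s *: v + x)))
       = (fun h => h^-1 *: ((f \o shift (s *: v + x)) (h *: v) - f (s *: v + x))).
  by apply/funext => h /=; rewrite -[h *: 1]/(h * 1) mulr1 scalerDl addrA.
by split => -[d1 d2]; split; move: d1 d2; rewrite /derivable /derive E.
Qed.

(** Only a directional derivative of the inner map is assumed. Restricted to the line through [x]
    along [v] that map becomes differentiable, since derivability in one variable is
    differentiability, and the chain rule for differentials applies. *)
Lemma is_derive_comp V W W' (f : V -> W) (F : W -> W') x v df :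
  is_derive x v f df -> differentiable F (f x) ->
  is_derive x v (fun y => F (f y)) ('D_df F (f x)).
Proof.
move=> df' dF; set l := (fun h : R => f (h *: v + x)).
have dl : is_derive (0 : R) 1 l df.
  by apply: (is_derive_line f x v 0 df).1; rewrite scale0r add0r.
have := (is_derive_line (fun y => F (f y)) x v 0 ('D_df F (f x))).2.
rewrite scale0r add0r; apply.
have dl1 : differentiable l 0 by apply/derivable1_diffP; case: dl.
have l0 : l 0 = f x by rewrite /l scale0r add0r.
have dF' : differentiable F (l 0) by rewrite l0.
split; first by apply/derivable1_diffP; exact: differentiable_comp.
rewrite deriveE; last exact: (differentiable_comp dl1 dF').
rewrite (diff_comp dl1 dF') /= l0 -deriveE//.
by have -> : 'd l 0 1 = df by case: dl => _ <-; rewrite deriveE.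
Qed.

Lemma is_derive_mx V p q (A : V -> 'M[R]_(p, q)) x v (dA : 'M[R]_(p, q)) :
  (forall i j, is_derive x v (fun y => A y i j) (dA i j)) <-> is_derive x v A dA.
Proof.
split=> [h|[h1 h2] i j].
  have d : derivable A x v by apply/derivable_mxP => i j; case: (h i j).
  split=> //; rewrite derive_mx//; apply/matrixP => i j; rewrite mxE.
  by case: (h i j).
split; first by move/derivable_mxP: h1.
by rewrite -h2 derive_mx// mxE.
Qed.

Lemma is_derive_sumf V W (I : finType) (h : I -> V -> W) x v dh :
  (forall i, is_derive x v (h i) (dh i)) ->
  is_derive x v (fun y => \sum_i h i y) (\sum_i dh i).
Proof.
move=> hh; have -> : (fun y => \sum_i h i y) = \sum_i h i.
  by apply/funext => y; rewrite fct_sumE.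
elim/big_ind2 : _ => [|f1 d1 f2 d2 h1 h2|i _]; last exact: hh.
  exact: is_derive_cst.
exact: is_deriveD.
Qed.

Lemma is_deriveMf V (f h : V -> R) x v (df dh : R) :
  is_derive x v f df -> is_derive x v h dh ->
  is_derive x v (fun y => f y * h y) (df * h x + f x * dh).
Proof.
move=> d1 d2; have := is_deriveM d1 d2.
by rewrite addrC /GRing.scale/= (mulrC (h x)).
Qed.

Lemma is_derive_mulmx V p q r (A : V -> 'M[R]_(p, q)) (B : V -> 'M[R]_(q, r)) x v dA dB :
  is_derive x v A dA -> is_derive x v B dB ->
  is_derive x v (fun y => A y *m B y) (dA *m B x + A x *m dB).
Proof.
move=> /is_derive_mx hA /is_derive_mx hB; apply/is_derive_mx => i j.
rewrite !mxE -big_split/=.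
have -> : (fun y => (A y *m B y) i j) = (fun y => \sum_k A y i k * B y k j).
  by apply/funext => y; rewrite mxE.
by apply: is_derive_sumf => k; apply: is_deriveMf.
Qed.

Lemma is_derive_trmx V p q (A : V -> 'M[R]_(p, q)) x v dA :
  is_derive x v A dA -> is_derive x v (fun y => (A y)^T) dA^T.
Proof.
move=> /is_derive_mx hA; apply/is_derive_mx => i j; rewrite mxE.
by under [X in is_derive _ _ X _]eq_fun do rewrite mxE.
Qed.

Lemma is_derive_scale V p q (k : V -> R) (A : V -> 'M[R]_(p, q)) x v dk dA :
  is_derive x v k dk -> is_derive x v A dA ->
  is_derive x v (fun y => k y *: A y) (dk *: A x + k x *: dA).
Proof.
move=> hk /is_derive_mx hA; apply/is_derive_mx => i j; rewrite !mxE.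
under [X in is_derive _ _ X _]eq_fun do rewrite mxE.
exact: is_deriveMf.
Qed.

Lemma is_derive_lsubmx V p q1 q2 (A : V -> 'M[R]_(p, q1 + q2)) x v dA :
  is_derive x v A dA -> is_derive x v (fun y => lsubmx (A y)) (lsubmx dA).
Proof.
move=> /is_derive_mx hA; apply/is_derive_mx => i j; rewrite mxE.
by under [X in is_derive _ _ X _]eq_fun do rewrite mxE.
Qed.

Lemma is_derive_rsubmx V p q1 q2 (A : V -> 'M[R]_(p, q1 + q2)) x v dA :
  is_derive x v A dA -> is_derive x v (fun y => rsubmx (A y)) (rsubmx dA).
Proof.
move=> /is_derive_mx hA; apply/is_derive_mx => i j; rewrite mxE.
by under [X in is_derive _ _ X _]eq_fun do rewrite mxE.
Qed.

Lemma is_deriveDf V W (f h : V -> W) x v df dh :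
  is_derive x v f df -> is_derive x v h dh ->
  is_derive x v (fun y => f y + h y) (df + dh).
Proof. by move=> ? ?; exact: is_deriveD. Qed.

Lemma is_deriveNf V W (f : V -> W) x v df :
  is_derive x v f df -> is_derive x v (fun y => - f y) (- df).
Proof. by move=> ?; exact: is_deriveN. Qed.

Lemma is_derive_cstf V W (a : W) (x v : V) : is_derive x v (fun=> a) 0.
Proof. exact: is_derive_cst. Qed.

Lemma is_derive_derive V W (f : V -> W) x v df : is_derive x v f df -> 'D_v f x = df.
Proof. by case. Qed.

(* Writing the second difference as an increment in the direction v of the
   increment along u, the mean value theorem along u reduces it to D_u f. *)
Lemma second_difference V (f : V -> R) (x u v : V) :
  (\forall y \near x, derivable f y u) -> differentiable ('D_u f) x ->
  forall e : R, 0 < e -> \forall h \near (0 : R)^'+,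
    `|(f (h *: u + (h *: v + x)) - f (h *: u + x)) - (f (h *: v + x) - f x)
      - h ^+ 2 * 'D_v ('D_u f) x| <= e * h ^+ 2.
Proof.
move=> fu dg e e0.
(* The two expansions of [g] used below have increments of total norm at most h (2 |u| + |v|); the
   added 1 keeps the denominator positive. *)
set g := 'D_u f; set e' := e / (`|u| + `|u| + `|v| + 1).
have D0 : 0 < `|u| + `|u| + `|v| + 1 by rewrite ltr_wpDl// !addr_ge0.
have e'0 : 0 < e' by rewrite divr_gt0.
have gx : \forall k \near (0 : V), `|g (k + x) - g x - 'd g x k| <= e' * `|k|.
  have /diff_locally/eqaddoP/(_ e' e'0) := dg; apply: filterS => k.
  by rewrite -![(_ + _ : _ -> _) _]/(_ + _) /= -![(- _ : _ -> _) _]/(- _) /= opprD addrA.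
have fu0 : \forall k \near (0 : V), derivable f (k + x) u.
  by move: fu; rewrite (near_shift 0) subr0.
have [r /= r0 rP] : exists2 r : R, 0 < r & forall k : V, `|k| < r ->
    `|g (k + x) - g x - 'd g x k| <= e' * `|k| /\ derivable f (k + x) u.
  have [r r0 rP] := (@nbhs_ballP _ _ _ _).1 (filterI gx fu0).
  exists r => // k kr; apply: rP; rewrite -ball_normE/= sub0r normrN//.
near=> h.
have h0 : 0 < h by [].
have hr c d : 0 <= c <= h -> 0 <= d <= h -> `|c *: u + d *: v| < r.
  move=> /andP[c0 ch] /andP[d0' dh].
  apply: (le_lt_trans (ler_normD _ _)); rewrite !normrZ (ger0_norm c0) (ger0_norm d0').
  apply: (@le_lt_trans _ _ (h * (`|u| + `|u| + `|v| + 1))).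
    have := ler_wpM2r (normr_ge0 u) ch; have := ler_wpM2r (normr_ge0 v) dh.
    by have := mulr_ge0 (ltW h0) (normr_ge0 u); lra.
  rewrite -ltr_pdivlMr//; near: h; apply: nbhs_right_lt; exact: divr_gt0.
have line d c : 0 <= c <= h -> 0 <= d <= h ->
    is_derive c 1 (fun s : R => f (s *: u + (d *: v + x))) (g (c *: u + (d *: v + x))).
  move=> hc hd; apply: (is_derive_line f _ u c _).1; apply: derivableP; rewrite addrA.
  by have [] := rP _ (hr _ _ hc hd).
have hh : 0 <= h <= h by apply/andP; split => //; exact: ltW.
have h00 : 0 <= (0 : R) <= h by apply/andP; split => //; exact: ltW.
(* The second difference is [F h - F 0]; writing [0 *: v] makes both terms instances of [line]. *)
pose F s := f (s *: u + (h *: v + x)) - f (s *: u + (0 *: v + x)).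
have dF c : 0 <= c <= h -> is_derive c 1 F (g (c *: u + (h *: v + x)) - g (c *: u + (0 *: v + x))).
  by move=> hc; apply: is_deriveB; apply: line.
have [c] := @MVT _ F (fun c => g (c *: u + (h *: v + x)) - g (c *: u + (0 *: v + x))) 0 h h0
  (fun c hc => dF c (ltac:(by move: hc; rewrite in_itv/= => /andP[/ltW-> /ltW->]))) 
  (ltac:(apply: derivable_within_continuous => c; rewrite in_itv/= => hc; by case: (dF c hc))).
rewrite in_itv/= => /andP[/ltW c0 /ltW ch]; rewrite /F subr0 !scale0r !add0r => ->.
have hc : 0 <= c <= h by rewrite c0.
have [g1 _] := rP _ (hr c h hc hh).
have [g2 _] := rP _ (hr c 0 hc h00).
rewrite deriveE//; set A := 'd g x u; set B := 'd g x v.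
have EA : 'd g x (c *: u) = c * A by rewrite linearZ.
have EB : 'd g x (c *: u + h *: v) = c * A + h * B by rewrite linearD !linearZ.
move: g1 g2; rewrite scale0r addr0 EA EB -(addrA (c *: u)).
set a := g (_ + (_ + x)); set b := g (_ + x) => g1 g2.
rewrite [X in `|X|](_ : _ = h * ((a - g x - (c * A + h * B)) - (b - g x - c * A)));
  last by ring.
rewrite normrM (gtr0_norm h0) expr2 mulrCA ler_pM2l//.
apply: (le_trans (ler_normB _ _)). apply: (le_trans (lerD g1 g2)).
rewrite -mulrDr /e' -mulrA ler_pM2l// mulrC ler_pdivrMr// mulrC.
apply: (le_trans (lerD (ler_normD _ _) (lexx _))); rewrite !normrZ (ger0_norm c0) (gtr0_norm h0).
by have := normr_ge0 u; have := normr_ge0 v; nra.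
Unshelve. all: by end_near. Qed.

(** The second difference is symmetric in [u] and [v], so for small h both mixed derivatives,
    multiplied by h^2, lie within e h^2 / 2 of the same number. *)
Lemma derive_comm_real V (f : V -> R) (x u v : V) :
  (\forall y \near x, differentiable f y) ->
  differentiable ('D_u f) x -> differentiable ('D_v f) x ->
  'D_v ('D_u f) x = 'D_u ('D_v f) x.
Proof.
move=> df du dv; apply/eqP; rewrite -subr_eq0 -normr_eq0 eq_le normr_ge0 andbT.
suff eps (e : R) : 0 < e -> `|'D_v ('D_u f) x - 'D_u ('D_v f) x| <= e.
  by apply/ler_addgt0Pl => e e0; rewrite addr0; exact: eps.
move=> e0; have e2 : 0 < e / 2 by rewrite divr_gt0.
have der w : \forall y \near x, derivable f y w.
  by apply: filterS df => y; exact: diff_derivable.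
have [h [h0 [h1 h2]]] := filter_ex (filterI (nbhs_right_gt (0 : R))
  (filterI (second_difference v (der u) du e2) (second_difference u (der v) dv e2))).
move: h1 h2; rewrite [h *: v + (h *: u + x)]addrCA.
set q := f _; set a := f _; set b := f _; set B := 'D_v _ x; set C := 'D_u _ x => h1 h2.
have hh : 0 < h ^+ 2 by rewrite exprn_gt0.
rewrite -(ler_pM2l hh) -[X in X * `|_|](gtr0_norm hh) -normrM.
have -> : h ^+ 2 * (B - C) = (q - b - (a - f x) - h ^+ 2 * C) - (q - a - (b - f x) - h ^+ 2 * B) by ring.
have E : h ^+ 2 * e = e / 2 * h ^+ 2 + e / 2 * h ^+ 2 by rewrite -mulrDl -splitr mulrC.
rewrite E; exact: (le_trans (ler_normB _ _) (lerD h2 h1)).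
Qed.

Lemma derive_comm V p q (f : V -> 'M[R]_(p, q)) (x u v : V) :
  (\forall y \near x, differentiable f y) ->
  differentiable ('D_u f) x -> differentiable ('D_v f) x ->
  'D_v ('D_u f) x = 'D_u ('D_v f) x.
Proof.
move=> df du dv.
have coord (h : V -> 'M[R]_(p, q)) y i j : differentiable h y ->
    differentiable (fun y => h y i j) y.
  move=> dh; apply: (@differentiable_comp _ _ _ _ h (fun M : 'M[R]_(p, q) => M i j)) => //.
  exact: differentiable_coord.
have dE w y i j : differentiable f y -> 'D_w f y i j = 'D_w (fun y => f y i j) y.
  by move=> d; rewrite derive_mx ?mxE//; exact: diff_derivable.
have nE w i j : \forall y \near x, 'D_w f y i j = 'D_w (fun y => f y i j) y.
  by apply: filterS df => y; exact: dE.
apply/matrixP => i j.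
rewrite (derive_mx (diff_derivable dv)) ?mxE (derive_mx (diff_derivable du)) ?mxE.
rewrite (near_eq_derive _ (nE u i j)) (near_eq_derive _ (nE v i j)).
apply: derive_comm_real; first by apply: filterS df => y; exact: coord.
- by apply: near_eq_differentiable (coord _ _ i j du); exact: nE.
- by apply: near_eq_differentiable (coord _ _ i j dv); exact: nE.
Qed.

End Calculus.

(** * Smooth functions *)

Section Smooth.
Context {R : realType} {V : normedModType R} {K : Type} (e : K -> V).
Implicit Types (W : normedModType R) (U : set V).

(** Derivatives are taken only along the family [e]: the coordinate vectors give smooth maps on
    charts, the single direction 1 gives smooth curves. The finite order [k] allows closure under
    products, inverses and composition to be proved by induction. *)
Fixpoint Ck W k U (f : V -> W) : Prop :=
  (forall x, U x -> differentiable f x) /\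
  if k is k'.+1 then forall i, Ck k' U ('D_(e i) f) else True.

Definition Cinf W U (f : V -> W) := forall k, Ck k U f.

Lemma Ck_diff W k U (f : V -> W) x : Ck k U f -> U x -> differentiable f x.
Proof. by case: k => [|k] []; auto. Qed.

Lemma CkS W k U (f : V -> W) : Ck k.+1 U f -> Ck k U f.
Proof. by elim: k f => [|k IH] f [df h]; split => // i; apply: IH. Qed.

Lemma Cinf_derive W U (f : V -> W) i : Cinf U f -> Cinf U ('D_(e i) f).
Proof. by move=> h k; have [_] := h k.+1; apply. Qed.

Lemma Cinf_iter W U (f : V -> W) :
  Cinf U f <-> forall (l : seq K) x, U x ->
    differentiable (foldr (fun i h => 'D_(e i) h) f l) x.
Proof.
split=> [hf l x Ux|hf k].
  suff : Cinf U (foldr (fun i h => 'D_(e i) h) f l) by move=> /(_ 0%N) [] h _; exact: h.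
  by elim: l => //= i l; apply: Cinf_derive.
elim: k f hf => [|k IH] f hf; split => //.
- exact: (hf [::]).
- exact: (hf [::]).
by move=> i; apply: IH => l x Ux; have := hf (rcons l i) x Ux; rewrite foldr_rcons.
Qed.

Lemma open_near U (P : V -> Prop) x : open U -> U x -> (forall y, U y -> P y) ->
  \forall y \near x, P y.
Proof. by move=> oU Ux h; apply: filterS (open_nbhs_nbhs (conj oU Ux)) => y; exact: h. Qed.

Lemma Ck_ext W k U (f h : V -> W) : open U -> (forall x, U x -> f x = h x) ->
  Ck k U f -> Ck k U h.
Proof.
move=> oU; elim: k f h => [|k IH] f h fh [df hf]; split => //.
- by move=> x Ux; apply: near_eq_differentiable (df x Ux); exact: open_near fh.
- by move=> x Ux; apply: near_eq_differentiable (df x Ux); exact: open_near fh.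
by move=> i; apply: IH (hf i) => x Ux; apply: near_eq_derive; exact: open_near fh.
Qed.

Lemma Ck_subset W k U U' (f : V -> W) : U' `<=` U -> Ck k U f -> Ck k U' f.
Proof.
move=> sub; elim: k f => [|k IH] f [df hf]; split => //.
- by move=> x /sub; exact: df.
- by move=> x /sub; exact: df.
by move=> i; apply: IH; exact: hf.
Qed.

Lemma Ck_cst W k U (a : W) : Ck k U (fun=> a).
Proof.
elim: k a => [|k IH] a; split => // i.
by have -> : 'D_(e i) (fun=> a) = (fun=> 0) by apply/funext => x; exact: derive_cst.
Qed.

Lemma Ck_add W k U (f h : V -> W) : open U -> Ck k U f -> Ck k U h ->
  Ck k U (fun x => f x + h x).
Proof.
move=> oU; elim: k f h => [|k IH] f h [df hf] [dh hh]; split => //.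
- by move=> x Ux; apply: differentiableD; auto.
- by move=> x Ux; apply: differentiableD; auto.
move=> i; apply: (Ck_ext oU _ (IH _ _ (hf i) (hh i))) => x Ux /=.
by rewrite -deriveD//; apply: diff_derivable; auto.
Qed.

Lemma Ck_mul k U (f h : V -> R) : open U -> Ck k U f -> Ck k U h ->
  Ck k U (fun x => f x * h x).
Proof.
move=> oU; elim: k f h => [|k IH] f h Hf Hh; have [df hf] := Hf; have [dh hh] := Hh; split => //.
- by move=> x Ux; apply: differentiableM; auto.
- by move=> x Ux; apply: differentiableM; auto.
move=> i; apply: (Ck_ext oU _ (Ck_add oU (IH _ _ (hf i) (CkS Hh)) (IH _ _ (CkS Hf) (hh i)))).
move=> x Ux /=; apply/esym/is_derive_derive.
by apply: is_deriveMf; apply: derivableP; apply: diff_derivable; auto.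
Qed.

Lemma Ck_sum W (I : Type) (r : seq I) (P : pred I) k U (f : I -> V -> W) : open U ->
  (forall i, P i -> Ck k U (f i)) -> Ck k U (fun x => \sum_(i <- r | P i) f i x).
Proof.
move=> oU hf; elim: r => [|i r IH].
  by have -> : (fun x => \sum_(i <- [::] | P i) f i x) = (fun=> 0);
    [apply/funext => x; rewrite big_nil|exact: Ck_cst].
have -> : (fun x => \sum_(i <- i :: r | P i) f i x) =
    (fun x => (if P i then f i x else 0) + \sum_(i <- r | P i) f i x).
  by apply/funext => x; rewrite big_cons; case: ifP; rewrite ?add0r.
by apply: Ck_add => //; case Pi: (P i); [exact: hf|exact: Ck_cst].
Qed.

Lemma Ck_prod (I : Type) (r : seq I) (P : pred I) k U (f : I -> V -> R) : open U ->
  (forall i, P i -> Ck k U (f i)) -> Ck k U (fun x => \prod_(i <- r | P i) f i x).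
Proof.
move=> oU hf; elim: r => [|i r IH].
  by have -> : (fun x => \prod_(i <- [::] | P i) f i x) = (fun=> 1);
    [apply/funext => x; rewrite big_nil|exact: Ck_cst].
have -> : (fun x => \prod_(i <- i :: r | P i) f i x) =
    (fun x => (if P i then f i x else 1) * \prod_(i <- r | P i) f i x).
  by apply/funext => x; rewrite big_cons; case: ifP; rewrite ?mul1r.
by apply: Ck_mul => //; case Pi: (P i); [exact: hf|exact: Ck_cst].
Qed.

Lemma Ck_inv k U (f : V -> R) : open U -> (forall x, U x -> f x != 0) ->
  Ck k U f -> Ck k U (fun x => (f x)^-1).
Proof.
move=> oU f0; elim: k => [|k IH] Hf; have [df hf] := Hf; split => //.
- by move=> x Ux; apply: differentiableV; auto.
- by move=> x Ux; apply: differentiableV; auto.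
have C := IH (CkS Hf).
move=> i; apply: (@Ck_ext _ _ _ (fun x => -1 * ((f x)^-1 * (f x)^-1 * 'D_(e i) f x))) => //;
  last first.
  apply: Ck_mul => //; first exact: Ck_cst.
  by apply: Ck_mul => //; [exact: Ck_mul|exact: hf].
move=> x Ux /=; rewrite deriveV ?f0//; last by apply: diff_derivable; auto.
by rewrite mulN1r -[_ *: _]/(_ * _) mulNr expr2 invfM.
Qed.

Lemma Ck_opp k U (f : V -> R) : open U -> Ck k U f -> Ck k U (fun x => - f x).
Proof.
move=> oU hf; apply: (@Ck_ext _ _ _ (fun x => -1 * f x)) => //; first by move=> x _; rewrite mulN1r.
by apply: Ck_mul => //; exact: Ck_cst.
Qed.

Lemma differentiable_mxP p q (A : V -> 'M[R]_(p, q)) x :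
  differentiable A x <-> forall i j, differentiable (fun y => A y i j) x.
Proof.
split=> [dA i j|h].
  apply: (@differentiable_comp _ _ _ _ A (fun M : 'M[R]_(p, q) => M i j)) => //.
  exact: differentiable_coord.
have -> : A = fun y => \sum_(k < p) \sum_(l < q) A y k l *: delta_mx k l.
  by apply/funext => y; rewrite [LHS]matrix_sum_delta.
have -> : (fun y => \sum_(k < p) \sum_(l < q) A y k l *: delta_mx k l) =
    \sum_(k < p) \sum_(l < q) (fun y => A y k l *: delta_mx k l : 'M[R]_(p, q)).
  by apply/funext => y; rewrite fct_sumE; apply: eq_bigr => k _; rewrite fct_sumE.
apply: differentiable_sum => k; apply: differentiable_sum => l.
exact: differentiableZl.
Qed.

Lemma Ck_mxP p q k U (A : V -> 'M[R]_(p, q)) : open U ->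
  Ck k U A <-> forall i j, Ck k U (fun y => A y i j).
Proof.
move=> oU; elim: k A => [|k IH] A.
  split=> [[dA _] i j|h]; split=> // x Ux.
    by move/differentiable_mxP: (dA x Ux).
  by apply/differentiable_mxP => i j; case: (h i j) => d _; exact: d.
split=> [[dA hA] i j|h]; split.
- by move=> x Ux; move/differentiable_mxP: (dA x Ux).
- move=> a; have /IH/(_ i j) := hA a; apply: Ck_ext => // x Ux.
  by rewrite derive_mx ?mxE//; apply: diff_derivable; auto.
- by move=> x Ux; apply/differentiable_mxP => i j; exact: Ck_diff (h i j) Ux.
move=> a; apply/IH => i j; have [_ /(_ a)] := h i j; apply: Ck_ext => // x Ux.
rewrite derive_mx ?mxE//; apply: diff_derivable.
by apply/differentiable_mxP => i' j'; exact: Ck_diff (h i' j') Ux.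
Qed.

Lemma Ck_mulmx p q r k U (A : V -> 'M[R]_(p, q)) (B : V -> 'M[R]_(q, r)) : open U ->
  Ck k U A -> Ck k U B -> Ck k U (fun x => A x *m B x).
Proof.
move=> oU /(Ck_mxP _ _ oU) hA /(Ck_mxP _ _ oU) hB; apply/(Ck_mxP _ _ oU) => i j.
under [X in Ck _ _ X]eq_fun do rewrite mxE.
by apply: Ck_sum => // l _; apply: Ck_mul.
Qed.

Lemma Ck_trmx p q k U (A : V -> 'M[R]_(p, q)) : open U ->
  Ck k U A -> Ck k U (fun x => (A x)^T).
Proof.
move=> oU /(Ck_mxP _ _ oU) hA; apply/(Ck_mxP _ _ oU) => i j.
by under [X in Ck _ _ X]eq_fun do rewrite mxE.
Qed.

Lemma Ck_det p k U (A : V -> 'M[R]_p) : open U ->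
  Ck k U A -> Ck k U (fun x => \det (A x)).
Proof.
move=> oU /(Ck_mxP _ _ oU) hA; apply: Ck_sum => // s _.
by apply: Ck_mul => //; [exact: Ck_cst|apply: Ck_prod].
Qed.

Lemma Ck_invmx p k U (A : V -> 'M[R]_p) : open U -> (forall x, U x -> A x \in unitmx) ->
  Ck k U A -> Ck k U (fun x => invmx (A x)).
Proof.
move=> oU uA hA; have /(Ck_mxP _ _ oU) eA := hA; apply/(Ck_mxP _ _ oU) => i j.
(* Cramer's rule makes the entries of the inverse rational in those of [A]. *)
apply: (@Ck_ext _ _ _ (fun x => (\det (A x))^-1 * ((-1) ^+ (j + i) *
    \det (row' j (col' i (A x)))))) => //.
  by move=> x Ux; rewrite /invmx uA// !mxE.
apply: Ck_mul => //.
  by apply: Ck_inv => //; [move=> x /uA; rewrite unitmxE unitfE|exact: Ck_det].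
apply: Ck_mul => //; first exact: Ck_cst.
apply: Ck_det => //; apply/(Ck_mxP _ _ oU) => a b.
by under [X in Ck _ _ X]eq_fun do rewrite !mxE.
Qed.

End Smooth.

Lemma derive_rowE {R : realType} n (W : normedModType R) (f : 'rV[R]_n -> W) u x :
  differentiable f x -> 'D_u f x = \sum_i u 0 i *: partial i f x.
Proof.
move=> df; rewrite deriveE// [in LHS](row_sum_delta u) linear_sum.
by apply: eq_bigr => i _; rewrite linearZ/= /partial deriveE.
Qed.

Section SmoothComp.
Context {R : realType} {V : normedModType R} {K : Type} (e : K -> V) {n : nat}.

Lemma Ck_comp k (U : set V) (O : set 'rV[R]_n) (c : V -> 'rV[R]_n) (F : 'rV[R]_n -> R) :
  open U -> (forall x, U x -> O (c x)) -> Ck e k U c ->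
  Ck (fun i => delta_mx 0 i) k O F -> Ck e k U (fun x => F (c x)).
Proof.
move=> oU cO; elim: k F => [|k IH] F Hc HF; split => //.
- by move=> x Ux; apply: differentiable_comp; [exact: Ck_diff Hc Ux|exact: Ck_diff HF (cO _ Ux)].
- by move=> x Ux; apply: differentiable_comp; [exact: Ck_diff Hc Ux|exact: Ck_diff HF (cO _ Ux)].
move=> a; apply: (@Ck_ext _ _ _ _ _ _ _
   (fun x => \sum_i ('D_(e a) c x) 0 i * partial i F (c x))) => //.
  move=> x Ux; apply/esym; rewrite (is_derive_derive (is_derive_comp (f := c) (df := 'D_(e a) c x) _ _)).
  - by rewrite derive_rowE//; exact: Ck_diff HF (cO _ Ux).
  - by apply: derivableP; apply: diff_derivable; exact: Ck_diff Hc Ux.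
  - exact: Ck_diff HF (cO _ Ux).
apply: Ck_sum => // i _; apply: Ck_mul => //.
  by have [_ /(_ a)/(Ck_mxP _ _ _ oU)] := Hc; apply.
by apply: IH; [exact: CkS Hc|exact: (proj2 HF i)].
Qed.

End SmoothComp.

(** * The Levi-Civita connection in a chart *)

(* Comparing derivatives up to conversion is very slow; algebraic identities are
   proved after abstracting them. *)
Ltac abstract_atoms :=
  repeat match goal with |- context [derive ?f ?x ?v] => generalize (derive f x v); intro end.

Section MxEntries.
Context {R : realType}.

Lemma mxDE p q (A B : 'M[R]_(p, q)) i j : (A + B) i j = A i j + B i j.
Proof. by rewrite mxE. Qed.

Lemma mxNE p q (A : 'M[R]_(p, q)) i j : (- A) i j = - A i j.
Proof. by rewrite mxE. Qed.

Lemma mxZE p q a (A : 'M[R]_(p, q)) i j : (a *: A) i j = a * A i j.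
Proof. by rewrite mxE. Qed.

Lemma mx0E p q i j : (0 : 'M[R]_(p, q)) i j = 0.
Proof. by rewrite mxE. Qed.

Lemma trmxD p q (A B : 'M[R]_(p, q)) : (A + B)^T = A^T + B^T.
Proof. by apply/matrixP => i j; rewrite !mxE. Qed.

Lemma trmxN p q (A : 'M[R]_(p, q)) : (- A)^T = - A^T.
Proof. by apply/matrixP => i j; rewrite !mxE. Qed.

End MxEntries.

Ltac mx_ring := apply/matrixP => ? ?; rewrite !(mxDE, mxNE, mx0E); ring.

Section Dot.
Context {R : realType} {n : nat}.
Implicit Types (G : 'M[R]_n) (u v w : 'rV[R]_n).

Lemma dotDl G u v w : dot G (u + v) w = dot G u w + dot G v w.
Proof. by rewrite /dot !mulmxDl mxDE. Qed.
Lemma dotDr G u v w : dot G u (v + w) = dot G u v + dot G u w.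
Proof. by rewrite /dot linearD/= mulmxDr mxDE. Qed.
Lemma dotNl G u v : dot G (- u) v = - dot G u v.
Proof. by rewrite /dot !mulNmx mxNE. Qed.
Lemma dotNr G u v : dot G u (- v) = - dot G u v.
Proof. by rewrite /dot linearN/= mulmxN mxNE. Qed.
Lemma dotZl G a u v : dot G (a *: u) v = a * dot G u v.
Proof. by rewrite /dot -!scalemxAl mxZE. Qed.
Lemma dotZr G a u v : dot G u (a *: v) = a * dot G u v.
Proof. by rewrite /dot linearZ/= -!scalemxAr mxZE. Qed.
Lemma dot0l G v : dot G 0 v = 0.
Proof. by rewrite /dot !mul0mx mx0E. Qed.
Lemma dot0r G v : dot G v 0 = 0.
Proof. by rewrite /dot linear0 mulmx0 mx0E. Qed.

Lemma dotD G G' u v : dot (G + G') u v = dot G u v + dot G' u v.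
Proof. by rewrite /dot mulmxDr mulmxDl mxDE. Qed.

Lemma dotC G u v : G^T = G -> dot G u v = dot G v u.
Proof.
move=> Gs; rewrite /dot -[u *m G *m v^T]trmxK mxE.
by rewrite !trmx_mul trmxK Gs mulmxA.
Qed.

Lemma dot_mull G (A : 'M[R]_n) u v : dot (A *m G) u v = dot G (u *m A) v.
Proof. by rewrite /dot mulmxA. Qed.

Lemma dot_mulr G (A : 'M[R]_n) u v : dot (G *m A^T) u v = dot G u (v *m A).
Proof. by rewrite /dot trmx_mul !mulmxA. Qed.

Lemma dot_delta G i j : dot G (delta_mx 0 i) (delta_mx 0 j) = G i j.
Proof. by rewrite /dot trmx_delta -rowE -colE !mxE. Qed.

Lemma dot_inj G u v : G \in unitmx -> (forall w, dot G u w = dot G v w) -> u = v.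
Proof.
move=> Gu h; suff : u *m G = v *m G by move/(can_inj (mulmxK Gu)).
apply/rowP => i; have := h (delta_mx 0 i).
by rewrite /dot trmx_delta -!colE !mxE.
Qed.

Lemma dot_eqmx G G' : (forall u v, dot G u v = dot G' u v) -> G = G'.
Proof. by move=> h; apply/matrixP => i j; rewrite -!dot_delta h. Qed.

Lemma is_derive_dot (V : normedModType R) (H : V -> 'M[R]_n) (X Y : V -> 'rV[R]_n)
    (t e : V) dH dX dY :
  is_derive t e H dH -> is_derive t e X dX -> is_derive t e Y dY ->
  is_derive t e (fun s => dot (H s) (X s) (Y s))
    (dot dH (X t) (Y t) + dot (H t) dX (Y t) + dot (H t) (X t) dY).
Proof.
move=> hH hX hY.
have /is_derive_mx/(_ 0 0) := is_derive_mulmx (is_derive_mulmx hX hH) (is_derive_trmx hY).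
by rewrite mulmxDl !mxDE [X in is_derive _ _ _ (X + _)]addrC.
Qed.

End Dot.

Definition coordv {R : realType} {n : nat} (i : 'I_n) : 'rV[R]_n := delta_mx 0 i.

Lemma smooth_onP (R : realType) n (W : normedModType R) (U : set 'rV[R]_n) (f : 'rV[R]_n -> W) :
  smooth_on U f <-> Cinf coordv U f.
Proof. by split=> [h|/Cinf_iter h]; [apply/Cinf_iter|]. Qed.

Lemma rowV_span_ind (R : realType) n (P : 'rV[R]_n -> Prop) :
  (forall u v, P u -> P v -> P (u + v)) -> (forall a u, P u -> P (a *: u)) ->
  (forall i, P (delta_mx 0 i)) -> P 0 -> forall u, P u.
Proof. by move=> PD PZ Pe P0 u; rewrite (row_sum_delta u); elim/big_ind: _ => // i _; exact: PZ. Qed.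

Section OpenDomain.
Context {R : realType} {n : nat}.
Variable O : set 'rV[R]_n.
Hypothesis oO : open O.

Lemma Cinf_diff (W : normedModType R) (f : 'rV[R]_n -> W) x :
  Cinf coordv O f -> O x -> differentiable f x.
Proof. by move=> /(_ 0%N) h; exact: Ck_diff h. Qed.

Lemma Cinf_is_derive (W : normedModType R) (f : 'rV[R]_n -> W) x v :
  Cinf coordv O f -> O x -> is_derive x v f ('D_v f x).
Proof. by move=> h Ox; apply: derivableP; apply: diff_derivable; exact: Cinf_diff h Ox. Qed.

Lemma Cinf_deriveE p q (f : 'rV[R]_n -> 'M[R]_(p, q)) x v i j :
  Cinf coordv O f -> O x -> 'D_v f x i j = \sum_k v 0 k * partial k (fun y => f y i j) x.
Proof.
move=> h Ox; rewrite derive_mx ?mxE; last by apply: diff_derivable; exact: Cinf_diff h Ox.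
rewrite derive_rowE//; have /differentiable_mxP := Cinf_diff h Ox; exact.
Qed.

Lemma derive_on (W : normedModType R) (f h : 'rV[R]_n -> W) x v dh :
  O x -> (forall y, O y -> f y = h y) -> is_derive x v h dh -> 'D_v f x = dh.
Proof.
move=> Ox fh hh; apply: is_derive_derive; apply: near_eq_is_derive hh.
by apply: open_near oO Ox _ => y Oy; rewrite fh.
Qed.

Lemma Cinf_derive_comm p q (f : 'rV[R]_n -> 'M[R]_(p, q)) x u v :
  Cinf coordv O f -> O x -> 'D_v ('D_u f) x = 'D_u ('D_v f) x.
Proof.
(* [Cinf] controls coordinate directions only, so a derivative along an arbitrary [w] is first
   written as a combination of partial derivatives. *)
move=> hf Ox; have d w : differentiable ('D_w f) x.
  apply: (@near_eq_differentiable _ _ _ (fun y => \sum_i w 0 i *: partial i f y)).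
    by apply: open_near oO Ox _ => y Oy; rewrite derive_rowE//; exact: Cinf_diff hf Oy.
  have -> : (fun y => \sum_i w 0 i *: partial i f y) = \sum_i (w 0 i *: partial i f).
    by apply/funext => y; rewrite fct_sumE.
  apply: differentiable_sum => i; apply: differentiableZ.
  exact: Cinf_diff (Cinf_derive i hf) Ox.
by apply: derive_comm => //; apply: open_near oO Ox _ => y; exact: Cinf_diff.
Qed.

End OpenDomain.

(** Nondegeneracy replaces positivity so that the metric induced on the [phi]-unit tangent bundle,
    which is indefinite, is also an instance. *)
Definition metric_on {R : realType} {n : nat} (G : 'rV[R]_n -> 'M[R]_n) (O : set 'rV[R]_n) :=
  [/\ open O, Cinf coordv O G, forall x, O x -> (G x)^T = G x &
      forall x, O x -> G x \in unitmx].

Definition parallel_on {R : realType} {n : nat} (G F : 'rV[R]_n -> 'M[R]_n) (O : set 'rV[R]_n) :=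
  [/\ Cinf coordv O F, forall x, O x -> F x *m G x = G x *m (F x)^T &
      forall x, O x -> forall i j k, cov_endo G F x i j k = 0].

Section Connection.
Context {R : realType} {n : nat}.
Variables (G : 'rV[R]_n -> 'M[R]_n) (O : set 'rV[R]_n).
Hypothesis Gm : metric_on G O.

Fact metric_on_open : open O. Proof. by case: Gm. Qed.
Fact metric_on_smooth : Cinf coordv O G. Proof. by case: Gm. Qed.
Fact metric_on_sym x : O x -> (G x)^T = G x. Proof. by case: Gm => _ _ h _; exact: h. Qed.
Fact metric_on_unit x : O x -> G x \in unitmx. Proof. by case: Gm => _ _ _; exact. Qed.

Hint Resolve metric_on_open metric_on_smooth : core.

(* Christoffel and curvature endomorphisms, acting on row vectors:
   v *m om x u = Gamma(u, v) and w *m rm x u v = R(u, v) w. *)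
Definition om x (u : 'rV[R]_n) : 'M[R]_n :=
  \matrix_(j, k) \sum_i u 0 i * christoffel G x i j k.

Definition rm x (u v : 'rV[R]_n) : 'M[R]_n :=
  \matrix_(k, l) \sum_i \sum_j u 0 i * v 0 j * riemann G x i j k l.

Lemma christoffel_appE x u v : christoffel_app G x u v = v *m om x u.
Proof.
apply/rowP => k; rewrite !mxE exchange_big/=; apply: eq_bigr => j _.
by rewrite mxE mulr_sumr; apply: eq_bigr => i _; rewrite [RHS]mulrCA [RHS]mulrA.
Qed.

Lemma omD x u v : om x (u + v) = om x u + om x v.
Proof.
apply/matrixP => j k; rewrite !mxE -big_split/=; apply: eq_bigr => i _.
by rewrite mxE mulrDl.
Qed.

Lemma omZ x a u : om x (a *: u) = a *: om x u.
Proof.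
apply/matrixP => j k; rewrite !mxE mulr_sumr; apply: eq_bigr => i _.
by rewrite mxE mulrA.
Qed.

Lemma rmDl x u u' v : rm x (u + u') v = rm x u v + rm x u' v.
Proof.
apply/matrixP => k l; rewrite !mxE -big_split/=; apply: eq_bigr => i _.
by rewrite -big_split/=; apply: eq_bigr => j _; rewrite mxE !mulrDl.
Qed.

Lemma rmDr x u v v' : rm x u (v + v') = rm x u v + rm x u v'.
Proof.
apply/matrixP => k l; rewrite !mxE -big_split/=; apply: eq_bigr => i _.
by rewrite -big_split/=; apply: eq_bigr => j _; rewrite mxE; ring.
Qed.

Lemma rmZl x a u v : rm x (a *: u) v = a *: rm x u v.
Proof.
apply/matrixP => k l; rewrite !mxE mulr_sumr; apply: eq_bigr => i _.
by rewrite mulr_sumr; apply: eq_bigr => j _; rewrite mxE; ring.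
Qed.

Lemma rmZr x a u v : rm x u (a *: v) = a *: rm x u v.
Proof.
apply/matrixP => k l; rewrite !mxE mulr_sumr; apply: eq_bigr => i _.
by rewrite mulr_sumr; apply: eq_bigr => j _; rewrite mxE; ring.
Qed.

Lemma Cinf_coef i j : Cinf coordv O (fun x => G x i j).
Proof. by move=> k; apply: (Ck_mxP _ _ _ metric_on_open).1; exact: metric_on_smooth. Qed.

Lemma Cinf_christoffel i j k : Cinf coordv O (fun x => christoffel G x i j k).
Proof.
move=> m; apply: Ck_mul => //; first exact: Ck_cst.
apply: Ck_sum => // l _; apply: Ck_mul => //; last first.
  have := Ck_invmx metric_on_open metric_on_unit (metric_on_smooth m); move/(Ck_mxP _ _ _ metric_on_open); exact.
have dG a b c : Ck coordv m O (partial a (fun y => G y b c)).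
  exact: (Cinf_derive _ (Cinf_coef b c)).
by apply: Ck_add => //; [apply: Ck_add|apply: Ck_opp].
Qed.

Lemma Cinf_riemann i j k l : Cinf coordv O (fun x => riemann G x i j k l).
Proof.
move=> m.
have dC a b c d : Ck coordv m O (partial a (fun y => christoffel G y b c d)).
  exact: (Cinf_derive _ (Cinf_christoffel b c d)).
have CC a b c a' b' c' :
    Ck coordv m O (fun x => christoffel G x a b c * christoffel G x a' b' c').
  by apply: Ck_mul => //; apply: Cinf_christoffel.
apply: Ck_add => //; last by apply: Ck_opp => //; apply: Ck_sum.
apply: Ck_add => //; last by apply: Ck_sum.
by apply: Ck_add => //; apply: Ck_opp.
Qed.

Lemma Cinf_om u : Cinf coordv O (fun x => om x u).
Proof.
move=> m; apply/Ck_mxP => // j k; under [X in Ck _ _ _ X]eq_fun do rewrite mxE.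
by apply: Ck_sum => // i _; apply: Ck_mul => //; [exact: Ck_cst|exact: Cinf_christoffel].
Qed.

Lemma Cinf_rm u v : Cinf coordv O (fun x => rm x u v).
Proof.
move=> m; apply/Ck_mxP => // j k; under [X in Ck _ _ _ X]eq_fun do rewrite mxE.
apply: Ck_sum => // i _; apply: Ck_sum => // l _; apply: Ck_mul => //.
  exact: Ck_cst.
exact: Cinf_riemann.
Qed.

Lemma om_sym x u v : O x -> v *m om x u = u *m om x v.
Proof.
move=> Ox; rewrite -!christoffel_appE; apply/rowP => k; rewrite !mxE exchange_big/=.
apply: eq_bigr => i _; apply: eq_bigr => j _; rewrite (@christoffelC _ _ G x j i k (open_near metric_on_open Ox metric_on_sym)).
by rewrite (mulrC (u 0 j)).
Qed.

Lemma metric_derive x u : O x -> 'D_u G x = om x u *m G x + G x *m (om x u)^T.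
Proof.
move=> Ox; apply/matrixP => i j; rewrite (Cinf_deriveE _ _ _ metric_on_smooth Ox) !mxE.
under eq_bigr do rewrite (christoffel_metric _ _ _ (open_near metric_on_open Ox metric_on_sym) (metric_on_unit Ox)) mulrDr !mulr_sumr.
rewrite big_split/=; congr (_ + _); rewrite exchange_big/=; apply: eq_bigr => l _.
  by rewrite mxE mulr_suml; apply: eq_bigr => k _; rewrite mulrA.
by rewrite !mxE mulr_sumr; apply: eq_bigr => k _; rewrite [RHS]mulrC mulrA.
Qed.

Lemma dot_metric_derive x u v w : O x ->
  dot ('D_u G x) v w = dot (G x) (v *m om x u) w + dot (G x) v (w *m om x u).
Proof. by move=> Ox; rewrite metric_derive// dotD dot_mull dot_mulr. Qed.

Lemma koszul x u v w : O x ->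
  2 * dot (G x) (v *m om x u) w =
    dot ('D_u G x) v w + dot ('D_v G x) u w - dot ('D_w G x) u v.
Proof.
move=> Ox; rewrite [X in _ = X + _ - _]dot_metric_derive//.
rewrite [X in _ = _ + X - _]dot_metric_derive// [X in _ = _ - X]dot_metric_derive//.
rewrite (om_sym v u Ox) (om_sym u w Ox) (om_sym v w Ox).
by rewrite (dotC v (u *m om x w) (metric_on_sym Ox)); ring.
Qed.

(** The base map has an arbitrary normed source, so that one Leibniz rule serves both curves in time
    and directions in the parameter space of the hypersurface. *)
Lemma is_derive_metric (V : normedModType R) (c X Y : V -> 'rV[R]_n) t e dc dX dY :
  O (c t) -> is_derive t e c dc -> is_derive t e X dX -> is_derive t e Y dY ->
  is_derive t e (fun s => dot (G (c s)) (X s) (Y s))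
    (dot (G (c t)) (dX + X t *m om (c t) dc) (Y t)
     + dot (G (c t)) (X t) (dY + Y t *m om (c t) dc)).
Proof.
move=> Oc hc hX hY.
have hG := is_derive_comp hc (Cinf_diff metric_on_smooth Oc).
have := is_derive_dot hG hX hY; rewrite (dot_metric_derive _ _ _ Oc) dotDl dotDr.
set a := dot _ _ _; set b := dot _ _ _; set a' := dot _ _ _; set b' := dot _ _ _.
by rewrite (_ : a + b + a' + b' = a' + a + (b' + b)); last ring.
Qed.

(** This is the form d omega + omega ^ omega of the curvature for constant [u] and [v]; it turns the
    curvature identities below into matrix algebra. *)
Lemma rmE x u v : O x -> rm x u v =
  'D_u (om ^~ v) x - 'D_v (om ^~ u) x + om x v *m om x u - om x u *m om x v.
Proof.
move=> Ox; apply/matrixP => k l.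
have DE a b : 'D_a (om ^~ b) x k l = \sum_i \sum_j a 0 i * b 0 j * partial i (fun y => christoffel G y j k l) x.
  rewrite (Cinf_deriveE _ _ _ (Cinf_om b) Ox); apply: eq_bigr => i _.
  have -> : (fun y => om y b k l) = (fun y => \sum_j b 0 j * christoffel G y j k l).
    by apply/funext => y; rewrite mxE.
  rewrite /partial (is_derive_derive (is_derive_sumf (dh := fun j => b 0 j * partial i (fun y => christoffel G y j k l) x) _)).
    by rewrite mulr_sumr; apply: eq_bigr => j _; rewrite mulrA.
  move=> j; have := is_deriveMf (is_derive_cstf (b 0 j) x (delta_mx 0 i)) (Cinf_is_derive (delta_mx 0 i) (Cinf_christoffel j k l) Ox).
  by rewrite mul0r add0r.
rewrite !mxDE !mxNE !DE !mxE.
have M a b : \sum_p om x b k p * om x a p l =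
   \sum_i \sum_j a 0 i * b 0 j * \sum_p christoffel G x j k p * christoffel G x i p l.
  under [RHS]eq_bigr do (under eq_bigr do rewrite mulr_sumr; rewrite exchange_big/=).
  rewrite [RHS]exchange_big/=; apply: eq_bigr => p _.
  rewrite !mxE big_distrlr/= exchange_big/=; apply: eq_bigr => i _; apply: eq_bigr => j _.
  by ring.
rewrite !M [X in _ - X + _ - _]exchange_big [X in _ - _ + _ - X]exchange_big/=.
rewrite -!sumrB -big_split/= -sumrB; apply: eq_bigr => i _.
rewrite -!sumrB -big_split/= -sumrB; apply: eq_bigr => j _.
rewrite /riemann.
by move: (partial i _ x) (partial j _ x) (\sum_p _) (\sum_p _) => a b c d; ring.
Qed.

Lemma rmC x u v : O x -> rm x u v = - rm x v u.
Proof. by move=> Ox; rewrite (rmE u v Ox) (rmE v u Ox); abstract_atoms; mx_ring. Qed.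

Lemma om_deriveC x u v w : O x ->
  w *m 'D_u (om ^~ v) x = v *m 'D_u (om ^~ w) x.
Proof.
move=> Ox.
have D (a : 'rV[R]_n) b : is_derive x u (fun y => a *m om y b) (a *m 'D_u (om ^~ b) x).
  have := is_derive_mulmx (is_derive_cstf a x u) (Cinf_is_derive u (Cinf_om b) Ox).
  by rewrite mul0mx add0r.
rewrite -(is_derive_derive (D w v)) -(is_derive_derive (D v w)).
by apply: near_eq_derive; apply: open_near metric_on_open Ox _ => y Oy; exact: om_sym.
Qed.

Lemma bianchi x u v w : O x -> w *m rm x u v + u *m rm x v w + v *m rm x w u = 0.
Proof.
move=> Ox; rewrite (rmE u v Ox) (rmE v w Ox) (rmE w u Ox).
move: (om_deriveC u v w Ox) (om_deriveC v u w Ox) (om_deriveC w v u Ox).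
move: (om_sym v w Ox) (om_sym u w Ox) (om_sym u v Ox); abstract_atoms.
move: (om x u) (om x v) (om x w) => a b c e1 e2 e3 e4 e5 e6.
rewrite !mulmxDr !mulmxN !mulmxA e1 e2 e3 e4 e5 e6; mx_ring.
Qed.

(** Second derivatives of [G] commute. Expressing them through [metric_derive], applied twice,
    leaves exactly this combination as the difference of the two orders. *)
Lemma rm_skew x u v : O x -> rm x u v *m G x + G x *m (rm x u v)^T = 0.
Proof.
move=> Ox.
have DD a b : 'D_b ('D_a G) x =
    'D_b (om ^~ a) x *m G x + om x a *m (om x b *m G x + G x *m (om x b)^T)
    + ((om x b *m G x + G x *m (om x b)^T) *m (om x a)^T + G x *m ('D_b (om ^~ a) x)^T).
  apply: (derive_on metric_on_open Ox (fun y Oy => metric_derive a Oy)).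
  have hO := Cinf_is_derive b (Cinf_om a) Ox.
  have hG := Cinf_is_derive b metric_on_smooth Ox; rewrite (metric_derive b Ox) in hG.
  apply: is_deriveDf; apply: is_derive_mulmx => //.
  exact: is_derive_trmx.
have := etrans (esym (DD u v)) (etrans (Cinf_derive_comm metric_on_open u v metric_on_smooth Ox) (DD v u)).
rewrite (rmE u v Ox); abstract_atoms; move: (om x u) (om x v) (G x) => a b g.
rewrite !(trmxD, trmxN) !trmx_mul !(mulmxDl, mulmxDr, mulNmx, mulmxN) !mulmxA.
by move=> /matrixP E; apply/matrixP => i j; have := E i j; rewrite !(mxDE, mxNE, mx0E); lra.
Qed.

Lemma dot_rm_skew x u v w z : O x ->
  dot (G x) (w *m rm x u v) z = - dot (G x) w (z *m rm x u v).
Proof.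
move=> Ox; apply/eqP; rewrite -subr_eq0 opprK -dot_mull -dot_mulr -dotD rm_skew//.
by rewrite /dot mulmx0 mul0mx mxE.
Qed.

Lemma dot_rm_pair x u v w z : O x ->
  dot (G x) (w *m rm x u v) z = dot (G x) (u *m rm x w z) v.
Proof.
move=> Ox; pose B a b c d := dot (G x) (c *m rm x a b) d.
have B1 a b c d : B a b c d = - B b a c d by rewrite /B (rmC a b Ox) mulmxN dotNl.
have B2 a b c d : B a b c d = - B a b d c.
  by rewrite /B dot_rm_skew// [dot _ _ (_ *m _)]dotC// metric_on_sym.
have B3 a b c d : B a b c d + B b c a d + B c a b d = 0.
  by rewrite /B -!dotDl bianchi// dot0l.
rewrite -/(B u v w z) -/(B w z u v).
(* The octahedron argument: one Bianchi identity for each choice of the fixed last argument, brought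
   to common terms by [B1] and [B2] and then combined linearly. *)
have E1 := B3 u v w z.
have E2 : B v w u z + B w z u v + B v z w u = 0.
  by have := B3 v w z u; rewrite (B2 v w z u) (B2 w z v u) (B1 z v w u); lra.
have E3 : B w z u v + B u z v w + B w u v z = 0.
  have := B3 w z u v.
  by rewrite (B1 z u w v) (B2 u z w v) (B1 u w z v) (B2 w u z v) !opprK.
have E4 : B u z v w + B u v w z + B v z w u = 0.
  by have := B3 z u v w; rewrite (B1 z u v w) (B2 u v z w) (B2 v z u w); lra.
lra.
Qed.

(* Pair symmetry moves the parallel endomorphism F from one skew pair of slots
   to the other, where it commutes with the curvature. *)
Section Parallel.
Variable F : 'rV[R]_n -> 'M[R]_n.
Hypothesis Fm : parallel_on G F O.

Fact parallel_on_smooth : Cinf coordv O F. Proof. by case: Fm. Qed.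
Fact parallel_on_self x : O x -> F x *m G x = G x *m (F x)^T. Proof. by case: Fm => _ h _; exact: h. Qed.
Fact parallel_on_par x : O x -> forall i j k, cov_endo G F x i j k = 0. Proof. by case: Fm => _ _; exact. Qed.

Lemma endo_derive x u : O x -> 'D_u F x = om x u *m F x - F x *m om x u.
Proof.
move=> Ox; apply/matrixP => j k; rewrite (Cinf_deriveE _ _ _ parallel_on_smooth Ox) mxDE mxNE !mxE.
apply/eqP; rewrite -subr_eq0 opprB; apply/eqP.
transitivity (\sum_i u 0 i * cov_endo G F x i j k); last first.
  by rewrite big1// => i _; rewrite parallel_on_par// mulr0.
under [RHS]eq_bigr do rewrite /cov_endo mulrBr mulrDr.
rewrite sumrB big_split -addrA/=; congr (_ + (_ - _)).
- under [RHS]eq_bigr do rewrite mulr_sumr; rewrite exchange_big/=; apply: eq_bigr => l _.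
  by rewrite mxE mulr_sumr; apply: eq_bigr => i _; rewrite mulrCA.
- under [RHS]eq_bigr do rewrite mulr_sumr; rewrite exchange_big/=; apply: eq_bigr => l _.
  by rewrite mxE mulr_suml; apply: eq_bigr => i _; rewrite [RHS]mulrA.
Qed.

(** The Ricci identity: second derivatives of [F] commute, and [endo_derive] applied twice shows
    that their difference is the commutator of the curvature with [F]. *)
Lemma rm_comm x u v : O x -> rm x u v *m F x = F x *m rm x u v.
Proof.
move=> Ox.
have DD a b : 'D_b ('D_a F) x =
    'D_b (om ^~ a) x *m F x + om x a *m (om x b *m F x - F x *m om x b)
    - ((om x b *m F x - F x *m om x b) *m om x a + F x *m 'D_b (om ^~ a) x).
  apply: (derive_on metric_on_open Ox (fun y Oy => endo_derive a Oy)).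
  have hO := Cinf_is_derive b (Cinf_om a) Ox.
  have hF := Cinf_is_derive b parallel_on_smooth Ox; rewrite (endo_derive b Ox) in hF.
  apply: is_deriveDf; first exact: is_derive_mulmx.
  by apply: is_deriveNf; exact: is_derive_mulmx.
have := etrans (esym (DD u v)) (etrans (Cinf_derive_comm metric_on_open u v parallel_on_smooth Ox) (DD v u)).
rewrite (rmE u v Ox); abstract_atoms; move: (om x u) (om x v) (F x) => a b f.
rewrite !(opprD, opprK, mulmxDl, mulmxDr, mulNmx, mulmxN) !mulmxA.
by move=> /matrixP E; apply/matrixP => i j; have := E i j; rewrite !(mxDE, mxNE); lra.
Qed.

Lemma dot_self x u v : O x -> dot (G x) (u *m F x) v = dot (G x) u (v *m F x).
Proof. by move=> Ox; rewrite -dot_mull -dot_mulr parallel_on_self. Qed.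

Lemma rm_pure x u v : O x -> rm x (u *m F x) v = rm x u (v *m F x).
Proof.
move=> Ox; apply/row_matrixP => i; rewrite !rowE; apply: (dot_inj (metric_on_unit Ox)) => w.
rewrite (dot_rm_pair (u *m F x) v _ w Ox) (dot_rm_pair u (v *m F x) _ w Ox).
by rewrite -mulmxA -(rm_comm _ _ Ox) mulmxA (dot_self _ _ Ox).
Qed.

(** By [rm_pure] exchanging [u] and [u *m F x] changes nothing, while antisymmetry changes the
    sign. *)
Lemma rm_diag x u : O x -> rm x u (u *m F x) = 0.
Proof.
move=> Ox; have := rm_pure u u Ox; rewrite (rmC (u *m F x) u Ox) => /matrixP E.
by apply/matrixP => i j; have := E i j; rewrite mxNE mx0E; lra.
Qed.

(** The derivative has the shape (D X) F minus a connection term, so that adding the connection term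
    of X F leaves D (X F) = (D X) F; callers do this with [subrK]. *)
Lemma is_derive_endo (V : normedModType R) (c X : V -> 'rV[R]_n) t e dc dX :
  O (c t) -> is_derive t e c dc -> is_derive t e X dX ->
  is_derive t e (fun s => X s *m F (c s))
    ((dX + X t *m om (c t) dc) *m F (c t) - X t *m F (c t) *m om (c t) dc).
Proof.
move=> Oc hc hX; have := is_derive_mulmx hX (is_derive_comp hc (Cinf_diff parallel_on_smooth Oc)).
by rewrite (endo_derive _ Oc) mulmxBr mulmxDl !mulmxA addrA.
Qed.

End Parallel.

Lemma is_derive_om (V : normedModType R) (c X : V -> 'rV[R]_n) t e dc dX :
  O (c t) -> is_derive t e c dc -> is_derive t e X dX ->
  is_derive t e (fun s => om (c s) (X s))
    ('D_dc (om ^~ (X t)) (c t) + om (c t) dX).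
Proof.
move=> Oc hc hX; apply/is_derive_mx => j k.
have -> : (fun s => om (c s) (X s) j k) = fun s => \sum_i X s 0 i * christoffel G (c s) i j k.
  by apply/funext => s; rewrite mxE.
rewrite mxDE (Cinf_deriveE _ _ _ (Cinf_om _) Oc) mxE.
have -> : \sum_l dc 0 l * partial l (fun y => om y (X t) j k) (c t) =
    \sum_i X t 0 i * 'D_dc (fun y => christoffel G y i j k) (c t).
  under [RHS]eq_bigr => i _ do
    rewrite (derive_rowE _ (Cinf_diff (Cinf_christoffel i j k) Oc)) mulr_sumr.
  rewrite exchange_big/=; apply: eq_bigr => l _.
  rewrite (_ : partial _ _ _ = \sum_i X t 0 i * partial l (fun y => christoffel G y i j k) (c t)).
    by rewrite mulr_sumr; apply: eq_bigr => i _; rewrite mulrCA.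
  apply: is_derive_derive; under [X in is_derive _ _ X _]eq_fun do rewrite mxE.
  apply: is_derive_sumf => i.
  have := is_deriveMf (is_derive_cstf (X t 0 i) (c t) (delta_mx 0 l))
    (Cinf_is_derive (delta_mx 0 l) (Cinf_christoffel i j k) Oc).
  by rewrite mul0r add0r.
rewrite addrC -big_split/=; apply: is_derive_sumf => i; apply: is_deriveMf.
  by move/is_derive_mx: hX; apply.
exact: is_derive_comp hc (Cinf_diff (Cinf_christoffel i j k) Oc).
Qed.

(* D_e D_f X - D_f D_e X for a field X over a map whose velocities in the two
   directions e and f are p and q, written with the common second derivatives
   pq of the map and XX of the field. *)
Lemma cov_comm x (X p q Xp Xq pq XX : 'rV[R]_n) : O x ->
  (XX + Xq *m om x p + X *m ('D_p (om ^~ q) x + om x pq) + X *m om x q *m om x p + Xp *m om x q)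
  - (XX + Xp *m om x q + X *m ('D_q (om ^~ p) x + om x pq) + X *m om x p *m om x q + Xq *m om x p)
  = X *m rm x p q.
Proof.
move=> Ox; rewrite (rmE p q Ox); abstract_atoms; move: (om x p) (om x q) (om x pq) => a b c.
rewrite !(mulmxDr, mulmxN) !mulmxA; mx_ring.
Qed.

Lemma om0 x : om x 0 = 0.
Proof. by rewrite -(scale0r 0) omZ scale0r. Qed.

Lemma rm0l x v : rm x 0 v = 0.
Proof. by rewrite -(scale0r 0) rmZl scale0r. Qed.

Lemma rm0r x u : rm x u 0 = 0.
Proof. by rewrite -(scale0r 0) rmZr scale0r. Qed.

Lemma om_delta x a j k : om x (delta_mx 0 a) j k = christoffel G x a j k.
Proof.
rewrite mxE (bigD1 a)//= big1 ?addr0; first by rewrite mxE !eqxx mul1r.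
by move=> i /negbTE ia; rewrite mxE ia andbF mul0r.
Qed.

Lemma rm_deltar x w j k l : rm x w (delta_mx 0 j) k l = \sum_i w 0 i * riemann G x i j k l.
Proof.
rewrite mxE; apply: eq_bigr => i _; rewrite (bigD1 j)//= big1 ?addr0.
  by rewrite mxE !eqxx mulr1.
by move=> a /negbTE ia; rewrite mxE ia andbF mulr0 mul0r.
Qed.

Lemma rm_deltal x w i k l : rm x (delta_mx 0 i) w k l = \sum_j w 0 j * riemann G x i j k l.
Proof.
rewrite mxE exchange_big/=; apply: eq_bigr => j _; rewrite (bigD1 i)//= big1 ?addr0.
  by rewrite mxE !eqxx mul1r.
by move=> a /negbTE ia; rewrite mxE ia andbF !mul0r.
Qed.

Lemma rm_delta x i j k l : rm x (delta_mx 0 i) (delta_mx 0 j) k l = riemann G x i j k l.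
Proof.
rewrite rm_deltar (bigD1 i)//= big1 ?addr0; first by rewrite mxE !eqxx mul1r.
by move=> a /negbTE ia; rewrite mxE ia andbF mul0r.
Qed.

(** * Derivative of the curvature along a map when the curvature is parallel *)

Section LocallySymmetric.
Hypothesis symm : forall x, O x -> forall p i j k l, cov_riemann G x p i j k l = 0.

Let rm_derive_delta x a i j : O x ->
  'D_(delta_mx 0 a) (fun y => rm y (delta_mx 0 i) (delta_mx 0 j)) x =
    rm x (delta_mx 0 i *m om x (delta_mx 0 a)) (delta_mx 0 j)
    + rm x (delta_mx 0 i) (delta_mx 0 j *m om x (delta_mx 0 a))
    + om x (delta_mx 0 a) *m rm x (delta_mx 0 i) (delta_mx 0 j)
    - rm x (delta_mx 0 i) (delta_mx 0 j) *m om x (delta_mx 0 a).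
Proof.
move=> Ox; apply/matrixP => k l.
have [hd _] := Cinf_is_derive (delta_mx 0 a) (Cinf_rm (delta_mx 0 i) (delta_mx 0 j)) Ox.
rewrite (derive_mx hd) mxE.
have -> : (fun y => rm y (delta_mx 0 i) (delta_mx 0 j) k l) = fun y => riemann G y i j k l.
  by apply/funext => y; rewrite rm_delta.
have T1 : rm x (delta_mx 0 i *m om x (delta_mx 0 a)) (delta_mx 0 j) k l =
    \sum_q christoffel G x a i q * riemann G x q j k l.
  by rewrite rm_deltar; apply: eq_bigr => q _; rewrite -rowE mxE om_delta.
have T2 : rm x (delta_mx 0 i) (delta_mx 0 j *m om x (delta_mx 0 a)) k l =
    \sum_q christoffel G x a j q * riemann G x i q k l.
  by rewrite rm_deltal; apply: eq_bigr => q _; rewrite -rowE mxE om_delta.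
have T3 : (om x (delta_mx 0 a) *m rm x (delta_mx 0 i) (delta_mx 0 j)) k l =
    \sum_q christoffel G x a k q * riemann G x i j q l.
  by rewrite mxE; apply: eq_bigr => q _; rewrite om_delta rm_delta.
have T4 : (rm x (delta_mx 0 i) (delta_mx 0 j) *m om x (delta_mx 0 a)) k l =
    \sum_q christoffel G x a q l * riemann G x i j k q.
  by rewrite mxE; apply: eq_bigr => q _; rewrite om_delta rm_delta [LHS]mulrC.
rewrite !(mxDE, mxNE) T1 T2 T3 T4.
have solve (A B C D E : R) : A - B - C - D + E = 0 -> A = B + C + D - E by move=> e; lra.
exact: solve (symm Ox a i j k l).
Qed.

(** The hypothesis concerns coordinate vectors. Both sides are linear in each of [p], [u] and [v],
    and one span induction per argument reaches arbitrary vectors. *)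
Lemma rm_derive x p u v : O x ->
  'D_p (fun y => rm y u v) x =
    rm x (u *m om x p) v + rm x u (v *m om x p) + om x p *m rm x u v - rm x u v *m om x p.
Proof.
move=> Ox.
have df u' v' := Cinf_diff (Cinf_rm u' v') Ox.
have isd u' v' p' : is_derive x p' (fun y => rm y u' v') ('D_p' (fun y => rm y u' v') x).
  exact: Cinf_is_derive (Cinf_rm u' v') Ox.
elim/rowV_span_ind: p.
- move=> p p' h h'.
  have -> : 'D_(p + p') (fun y => rm y u v) x = 'D_p (fun y => rm y u v) x + 'D_p' (fun y => rm y u v) x.
    by rewrite !deriveE// linearD.
  rewrite {}h {}h' !(omD, mulmxDr, mulmxDl, rmDl, rmDr); mx_ring.
- move=> a p h.
  have -> : 'D_(a *: p) (fun y => rm y u v) x = a *: 'D_p (fun y => rm y u v) x.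
    by rewrite !deriveE// linearZ.
  by rewrite {}h omZ -!scalemxAr rmZl rmZr -!scalemxAl !(scalerDr, scalerN).
- move=> a; elim/rowV_span_ind: u.
  + move=> u u' h h'.
    have -> : (fun y => rm y (u + u') v) = (fun y => rm y u v + rm y u' v).
      by apply/funext => y; rewrite rmDl.
    rewrite (is_derive_derive (is_deriveDf (isd u v _) (isd u' v _))).
    rewrite {}h {}h' !(mulmxDr, mulmxDl, rmDl, rmDr); mx_ring.
  + move=> b u h.
    have -> : (fun y => rm y (b *: u) v) = (fun y => b *: rm y u v).
      by apply/funext => y; rewrite rmZl.
    have /is_derive_derive -> := is_derive_scale (is_derive_cstf b x (delta_mx 0 a)) (isd u v (delta_mx 0 a)).
    by rewrite {}h scale0r add0r -!scalemxAl !rmZl -scalemxAr -scalemxAl !(scalerDr, scalerN).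
  + move=> i; elim/rowV_span_ind: v.
    * move=> v v' h h'.
      have -> : (fun y => rm y (delta_mx 0 i) (v + v')) =
                (fun y => rm y (delta_mx 0 i) v + rm y (delta_mx 0 i) v').
        by apply/funext => y; rewrite rmDr.
      rewrite (is_derive_derive (is_deriveDf (isd _ v _) (isd _ v' _))).
      rewrite {}h {}h' !(mulmxDr, mulmxDl, rmDl, rmDr); mx_ring.
    * move=> b v h.
      have -> : (fun y => rm y (delta_mx 0 i) (b *: v)) = (fun y => b *: rm y (delta_mx 0 i) v).
        by apply/funext => y; rewrite rmZr.
      have /is_derive_derive -> := is_derive_scale (is_derive_cstf b x (delta_mx 0 a)) (isd (delta_mx 0 i) v (delta_mx 0 a)).
      by rewrite {}h scale0r add0r -!scalemxAl !rmZr -scalemxAr -scalemxAl !(scalerDr, scalerN).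
    * by move=> j; exact: rm_derive_delta.
    * have -> : (fun y => rm y (delta_mx 0 i) 0) = (fun=> 0) by apply/funext => y; rewrite rm0r.
      by rewrite (is_derive_derive (is_derive_cstf _ _ _)) mul0mx !rm0r mulmx0 mul0mx subr0 !addr0.
  + have -> : (fun y => rm y 0 v) = (fun=> 0) by apply/funext => y; rewrite rm0l.
    by rewrite (is_derive_derive (is_derive_cstf _ _ _)) mul0mx !rm0l mulmx0 mul0mx subr0 !addr0.
- by rewrite derive0 om0 !mulmx0 rm0l rm0r mul0mx subr0 !addr0.
Qed.

Lemma is_derive_rm (V : normedModType R) (c X Y : V -> 'rV[R]_n) t e dc dX dY :
  O (c t) -> is_derive t e c dc -> is_derive t e X dX -> is_derive t e Y dY ->
  is_derive t e (fun s => rm (c s) (X s) (Y s))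
    (rm (c t) (dX + X t *m om (c t) dc) (Y t) + rm (c t) (X t) (dY + Y t *m om (c t) dc)
     + (om (c t) dc *m rm (c t) (X t) (Y t) - rm (c t) (X t) (Y t) *m om (c t) dc)).
Proof.
move=> Oc hc hX hY.
(* Over coordinate vectors, [X] and [Y] enter only through scalar coefficients, which separates
   their derivatives from that of the base point. *)
have cE s : rm (c s) (X s) (Y s) = \sum_i \sum_j (X s 0 i * Y s 0 j) *: rm (c s) (delta_mx 0 i) (delta_mx 0 j).
  apply/matrixP => k l; rewrite mxE summxE; apply: eq_bigr => i _.
  by rewrite summxE; apply: eq_bigr => j _; rewrite mxZE rm_delta.
have -> : (fun s => rm (c s) (X s) (Y s)) = fun s =>
    \sum_i \sum_j (X s 0 i * Y s 0 j) *: rm (c s) (delta_mx 0 i) (delta_mx 0 j).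
  by apply/funext.
have hd i j := is_derive_comp hc (Cinf_diff (Cinf_rm (delta_mx 0 i) (delta_mx 0 j)) Oc).
have hij i j := is_derive_scale (is_deriveMf ((is_derive_mx _ _ _ _).2 hX 0 i) ((is_derive_mx _ _ _ _).2 hY 0 j)) (hd i j).
apply: is_derive_eq; first by apply: is_derive_sumf => i; apply: is_derive_sumf => j; exact: hij.
transitivity (rm (c t) dX (Y t) + rm (c t) (X t) dY + 'D_dc (fun y => rm y (X t) (Y t)) (c t)).
  apply/matrixP => k l.
  have -> : (fun y => rm y (X t) (Y t)) = fun y =>
      \sum_i \sum_j (X t 0 i * Y t 0 j) *: rm y (delta_mx 0 i) (delta_mx 0 j).
    apply/funext => y; apply/matrixP => k' l'; rewrite mxE summxE; apply: eq_bigr => i _.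
    by rewrite summxE; apply: eq_bigr => j _; rewrite mxZE rm_delta.
  have hs i j := is_derive_scale (is_derive_cstf (X t 0 i * Y t 0 j) (c t) dc)
     (Cinf_is_derive dc (Cinf_rm (delta_mx 0 i) (delta_mx 0 j)) Oc).
  have /is_derive_derive -> := is_derive_sumf (fun i => is_derive_sumf (hs i)).
  rewrite !mxDE !summxE !mxE -!big_split/=; apply: eq_bigr => i _.
  rewrite !summxE -!big_split/=; apply: eq_bigr => j _.
  by rewrite !(mxDE, mxZE) rm_delta; ring.
rewrite (rm_derive _ _ _ Oc) !(rmDl, rmDr).
by move: (rm _ dX _) (rm _ _ dY) (rm _ (_ *m _) _) (rm _ _ (_ *m _)) (_ *m rm _ _ _) (rm _ _ _ *m _) => *; mx_ring.
Qed.

End LocallySymmetric.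

End Connection.

(** * Geodesics of the phi-unit tangent bundle *)

Lemma derivable_is_derive (R : realType) (W : normedModType R) (f : R -> W) t :
  derivable f t 1 -> is_derive t 1 f (derive1 f t).
Proof. by move=> d; rewrite derive1E; exact: derivableP. Qed.

Lemma dot_trmx (R : realType) n (g : 'M[R]_n) u v : dot g^T u v = dot g v u.
Proof. by rewrite /dot -[v *m g *m u^T]trmxK [RHS]mxE !trmx_mul trmxK mulmxA. Qed.

(* If X is phi-orthogonal to everything phi-orthogonal to the phi-unit vector
   v, then X is a multiple of v. *)
Lemma perp_colinear (R : realType) n (g f : 'M[R]_n) (v X : 'rV[R]_n) :
  g \in unitmx -> f *m f = 1%:M -> f *m g = g *m f^T -> dot g v (v *m f) = 1 ->
  (forall q, dot g v (q *m f) = 0 -> dot g X (q *m f) = 0) ->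
  X = dot g X (v *m f) *: v.
Proof.
move=> gu ff fg v1 h.
have self a b : dot g (a *m f) b = dot g a (b *m f) by rewrite -dot_mull fg dot_mulr.
have key w : dot g X (w *m f) = dot g v (w *m f) * dot g X (v *m f).
  (* The test vector is the projection of [w] onto the [phi]-orthogonal complement of [v]. *)
  have := h (w - dot g v (w *m f) *: v).
  rewrite mulmxBl -scalemxAl !dotDr !dotNr !dotZr v1 mulr1 subrr => /(_ erefl) /eqP.
  by rewrite subr_eq0 => /eqP.
suff : X *m f = (dot g X (v *m f) *: v) *m f.
  by move=> /(congr1 (mulmx^~ f)); rewrite -!mulmxA ff !mulmx1.
apply: (dot_inj gu) => w; rewrite !self key dotZl mulrC; congr (_ * _).
Qed.

Section Jacobian.
Context {R : realType} {n m : nat}.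
Variables (U : set 'rV[R]_n) (P : 'rV[R]_n -> 'rV[R]_m).
Hypothesis oU : open U.
Hypothesis Psm : Cinf coordv U P.

Lemma derive_jacobian y w : U y -> 'D_w P y = w *m jacobian P y.
Proof. by move=> Uy; rewrite deriveEjacobian//; exact: Cinf_diff Psm Uy. Qed.

Lemma Cinf_jacobian : Cinf coordv U (jacobian P).
Proof.
move=> k; apply/Ck_mxP => // a b.
apply: (@Ck_ext _ _ _ _ _ _ _ (fun y => 'D_(coordv a) P y 0 b)) => //.
  by move=> y Uy; rewrite derive_jacobian// -rowE mxE.
by have /(Ck_mxP _ _ _ oU) := Cinf_derive a Psm k; apply.
Qed.

(** Both sides are the second derivative of [P] along [a] and [w]. *)
Lemma jacobian_derive_sym y a w : U y ->
  a *m 'D_w (jacobian P) y = w *m 'D_a (jacobian P) y.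
Proof.
move=> Uy.
have D (b : 'rV[R]_n) c : is_derive y c (fun y => b *m jacobian P y) (b *m 'D_c (jacobian P) y).
  have := is_derive_mulmx (is_derive_cstf b y c) (Cinf_is_derive c Cinf_jacobian Uy).
  by rewrite mul0mx add0r.
have E b c : 'D_c ('D_b P) y = b *m 'D_c (jacobian P) y.
  by apply: (derive_on oU Uy _ (D b c)) => z Uz; exact: derive_jacobian.
by rewrite -(E a w) -(E w a); exact: (Cinf_derive_comm oU).
Qed.

End Jacobian.

(** The first equation is the time derivative of the product of the velocity (y, e) with the
    variation (p, q), the second the derivative of the squared velocity along the variation; [C] is
    the mixed derivative of the base point. Subtracting half of the second cancels [C] and [X], and
    leaves in [Dq - Ds] the commutator that becomes curvature. *)
Lemma variation_algebra (R : realType) n (g f : 'M[R]_n) (y p Dy C De q e Dq Ds : 'rV[R]_n) (X : R) :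
  g^T = g -> f *m g = g *m f^T ->
  dot g Dy p + dot g y C + (dot g De (q *m f) + dot g e (Dq *m f)) = X ->
  dot g C y + dot g y C + (dot g Ds (e *m f) + dot g e (Ds *m f)) = X + X ->
  dot g Dy p + dot g De (q *m f) + dot g e ((Dq - Ds) *m f) = 0.
Proof.
move=> gs fs; rewrite (dotC C y gs) -[dot g Ds (e *m f)]dot_mulr -fs dot_mull (dotC (Ds *m f) e gs).
by rewrite mulmxBl dotDr dotNr; lra.
Qed.

(** * The metric induced on a parametrized piece of the phi-unit tangent bundle *)

Section Hypersurface.
Context {R : realType} {n : nat}.
Variables (G F : 'rV[R]_n -> 'M[R]_n) (O : set 'rV[R]_n).
Hypothesis Gm : metric_on G O.
Hypothesis Fm : parallel_on G F O.
Hypothesis FF : forall x, O x -> F x *m F x = 1%:M.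

Variables (U : set 'rV[R]_(n + n).-1) (P : 'rV[R]_(n + n).-1 -> 'rV[R]_(n + n)).
Hypothesis oU : open U.
Hypothesis Psm : Cinf coordv U P.
Hypothesis Pfree : forall y, U y -> row_free (jacobian P y).
Hypothesis PO : forall y, U y -> O (lsubmx (P y)).
Hypothesis P1 : forall y, U y ->
  dot (G (lsubmx (P y))) (rsubmx (P y)) (rsubmx (P y) *m F (lsubmx (P y))) = 1.

Let dmetric := is_derive_metric Gm.
Let J := jacobian P.
Let bx y := lsubmx (P y).
Let fv y := rsubmx (P y).

Definition induced y : 'M[R]_((n + n).-1) :=
  \matrix_(a, b) sasaki G F (P y) (row a (jacobian P y)) (row b (jacobian P y)).

(** The vertical part, with base point and fibre vector as separate arguments, so that it can be
    differentiated while all three vary. *)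
Let vp x v (a : 'rV[R]_(n + n)) := rsubmx a + v *m om G x (lsubmx a).

Let sasakiE z a b : sasaki G F z a b =
  dot (G (lsubmx z)) (lsubmx a) (lsubmx b)
  + dot (G (lsubmx z)) (vp (lsubmx z) (rsubmx z) a) (vp (lsubmx z) (rsubmx z) b *m F (lsubmx z)).
Proof. by rewrite /sasaki /vpart !christoffel_appE. Qed.

Let vpD x v a b : vp x v (a + b) = vp x v a + vp x v b.
Proof. by rewrite /vp !linearD/= omD mulmxDr addrACA. Qed.

Let vpZ x v c a : vp x v (c *: a) = c *: vp x v a.
Proof. by rewrite /vp !linearZ/= omZ -scalemxAr scalerDr. Qed.

Let sasakiDl z a a' b : sasaki G F z (a + a') b = sasaki G F z a b + sasaki G F z a' b.
Proof. by rewrite !sasakiE vpD linearD/= !dotDl; ring. Qed.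

Let sasakiDr z a b b' : sasaki G F z a (b + b') = sasaki G F z a b + sasaki G F z a b'.
Proof. by rewrite !sasakiE vpD linearD/= mulmxDl !dotDr; ring. Qed.

Let sasakiZl z c a b : sasaki G F z (c *: a) b = c * sasaki G F z a b.
Proof. by rewrite !sasakiE vpZ linearZ/= !dotZl; ring. Qed.

Let sasakiZr z c a b : sasaki G F z a (c *: b) = c * sasaki G F z a b.
Proof. by rewrite !sasakiE vpZ linearZ/= -scalemxAl !dotZr; ring. Qed.

Let inducedE y a b : dot (induced y) a b = sasaki G F (P y) (a *m J y) (b *m J y).
Proof.
have bb i d : dot (induced y) (delta_mx 0 i) d = sasaki G F (P y) (delta_mx 0 i *m J y) (d *m J y).
  move: d; apply: rowV_span_ind => [d d' h h'|c d h|j|].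
  - by rewrite dotDr h h' mulmxDl sasakiDr.
  - by rewrite dotZr h -scalemxAl sasakiZr.
  - by rewrite dot_delta mxE !rowE.
  - by rewrite dot0r mul0mx; have := sasakiZr (P y) 0 (delta_mx 0 i *m J y) 0; rewrite scale0r mul0r.
move: a; apply: rowV_span_ind => [a a' h h'|c a h|i|]; last 2 first.
- exact: bb.
- by rewrite dot0l mul0mx; have := sasakiZl (P y) 0 0 (b *m J y); rewrite scale0r mul0r.
- by rewrite dotDl h h' mulmxDl sasakiDl.
- by rewrite dotZl h -scalemxAl sasakiZl.
Qed.

Let isd_P y w : U y -> is_derive y w P (w *m J y).
Proof. by move=> Uy; rewrite -(derive_jacobian Psm w Uy); exact: Cinf_is_derive Psm Uy. Qed.

Let isd_bx y w : U y -> is_derive y w bx (lsubmx (w *m J y)).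
Proof. by move=> Uy; apply: is_derive_lsubmx; exact: isd_P. Qed.

Let isd_fv y w : U y -> is_derive y w fv (rsubmx (w *m J y)).
Proof. by move=> Uy; apply: is_derive_rsubmx; exact: isd_P. Qed.

Let Jsm : Cinf coordv U J := Cinf_jacobian oU Psm.

Let isd_J y w : U y -> is_derive y w J ('D_w J y).
Proof. exact: Cinf_is_derive Jsm. Qed.

Let self y a b : U y -> dot (G (bx y)) (a *m F (bx y)) b = dot (G (bx y)) a (b *m F (bx y)).
Proof. by move=> Uy; exact: (dot_self Fm a b (PO Uy)). Qed.

Let dsym y a b : U y -> dot (G (bx y)) a b = dot (G (bx y)) b a.
Proof. by move=> Uy; apply: dotC; exact: (metric_on_sym Gm (PO Uy)). Qed.

(** Differentiating the constraint [P1] along [w] gives twice this product, by self-adjointness of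
    [F]. *)
Let tangent y w : U y ->
  dot (G (bx y)) (fv y) (vp (bx y) (fv y) (w *m J y) *m F (bx y)) = 0.
Proof.
move=> Uy; have Oy : O (bx y) := PO Uy.
have hF := is_derive_endo Fm (c := bx) (X := fv) Oy (isd_bx w Uy) (isd_fv w Uy).
have := dmetric (c := bx) (X := fv) Oy (isd_bx w Uy) (isd_fv w Uy) hF.
rewrite subrK -/(vp (bx y) (fv y) (w *m J y)).
have h1 : is_derive y w (fun s => dot (G (bx s)) (fv s) (fv s *m F (bx s))) 0.
  apply: near_eq_is_derive (is_derive_cstf (1 : R) y w).
  by apply: (open_near oU Uy) => z Uz; rewrite P1.
move=> /is_derive_derive; rewrite (is_derive_derive h1) -[bx y]/(lsubmx (P y)) => /esym.
rewrite [X in X + _](_ : _ = dot (G (bx y)) (fv y) (vp (bx y) (fv y) (w *m J y) *m F (bx y))).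
  by rewrite -[lsubmx (P y)]/(bx y); lra.
by rewrite -[lsubmx (P y)]/(bx y) -self// dsym.
Qed.

(** Converse of [tangent], by counting dimensions: the rows of the Jacobian lie in the kernel of the
    linear form [K], which is nonzero because its value on the vertical lift of [fv y] is 1. Both
    spaces have dimension [(n + n).-1], so they coincide. *)
Let span y p q : U y ->
  dot (G (bx y)) (fv y) ((q + fv y *m om G (bx y) p) *m F (bx y)) = 0 ->
  exists w, w *m J y = row_mx p q.
Proof.
move=> Uy h0; have Oy : O (bx y) := PO Uy.
(* [K] represents a |-> g(v, phi (vp a)); symmetry of the connection rewrites v *m om p as p *m om
   v, which makes the dependence on the horizontal part p a matrix product. *)
pose K2 := F (bx y) *m G (bx y) *m (fv y)^T.
pose K := col_mx (om G (bx y) (fv y) *m K2) K2.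
have KE a : (a *m K) 0 0 = dot (G (bx y)) (fv y) (vp (bx y) (fv y) a *m F (bx y)).
  rewrite -[in LHS](hsubmxK a) mul_row_col mulmxA -mulmxDl dsym// /dot /vp.
  by rewrite (om_sym Gm _ _ Oy) addrC !mulmxA.
have JK : J y *m K = 0.
  apply/matrixP => i j; rewrite (ord1 j) mx0E.
  by have := tangent (delta_mx 0 i) Uy; rewrite -KE -mulmxA -rowE [LHS]mxE.
have K0 : K != 0.
  apply/eqP => K0; have := KE (row_mx 0 (fv y)); rewrite K0 mulmx0 mx0E /vp row_mxKl row_mxKr.
  by rewrite om0 mulmx0 addr0 P1// => /eqP; rewrite eq_sym oner_eq0.
have rK : \rank K = 1%N.
  by apply/eqP; rewrite eqn_leq rank_leq_col lt0n mxrank_eq0.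
have JleK : (J y <= kermx K)%MS by rewrite sub_kermx JK.
have KleJ : (kermx K <= J y)%MS.
  have [_] := mxrank_leqif_eq JleK.
  rewrite mxrank_ker rK subn1 (eqP (Pfree Uy)) eqxx => /esym.
  by case/andP.
have : (row_mx p q <= kermx K)%MS.
  rewrite sub_kermx; apply/eqP/matrixP => i j; rewrite !ord1 mx0E KE /vp row_mxKl row_mxKr.
  exact: h0.
by move=> /submx_trans/(_ KleJ)/submxP[w ->]; exists w.
Qed.

(** A vector orthogonal to the whole tangent space has zero horizontal part, since horizontal test
    vectors are free. By [perp_colinear] its vertical part is a multiple of [fv y], and the factor
    is 0 because the vector is itself tangent. *)
Let induced_unit y : U y -> induced y \in unitmx.
Proof.
move=> Uy; have Oy : O (bx y) := PO Uy.
rewrite -row_free_unit -kermx_eq0; apply/rowV0P => w /sub_kermxP wh.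
have h b : sasaki G F (P y) (w *m J y) (b *m J y) = 0.
  by rewrite -inducedE /dot wh mul0mx mx0E.
have key p q : dot (G (bx y)) (fv y) (q *m F (bx y)) = 0 ->
    dot (G (bx y)) (lsubmx (w *m J y)) p
    + dot (G (bx y)) (vp (bx y) (fv y) (w *m J y)) (q *m F (bx y)) = 0.
  move=> h0; have [|b Eb] := @span y p (q - fv y *m om G (bx y) p) Uy.
    by rewrite subrK.
  by have := h b; rewrite Eb sasakiE /vp row_mxKl row_mxKr subrK.
have l0 : lsubmx (w *m J y) = 0.
  apply: (dot_inj (metric_on_unit Gm Oy)) => p; rewrite dot0l.
  by have := key p 0; rewrite !mul0mx !dot0r addr0; apply.
have r0 : vp (bx y) (fv y) (w *m J y) = 0.
  rewrite (@perp_colinear _ _ (G (bx y)) (F (bx y)) (fv y) (vp _ _ _)).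
  - by rewrite -self// dsym// tangent// scale0r.
  - exact: (metric_on_unit Gm Oy).
  - exact: FF.
  - exact: (parallel_on_self Fm Oy).
  - exact: P1.
  - by move=> q h0; have := key 0 q h0; rewrite dot0r add0r.
apply/eqP; rewrite -(mulmx_free_eq0 _ (Pfree Uy)); apply/eqP.
rewrite -[LHS]hsubmxK l0; move: r0; rewrite /vp l0 om0 mulmx0 addr0 => ->.
by rewrite row_mx0.
Qed.

Let Ck_at k (f : 'rV[R]_n -> R) : Cinf coordv O f -> Ck coordv k U (fun y => f (bx y)).
Proof.
move=> hf; apply: (Ck_comp oU PO) (hf k).
apply/(Ck_mxP _ _ _ oU) => i j; under [X in Ck _ _ _ X]eq_fun do rewrite mxE.
by have /(Ck_mxP _ _ _ oU) := Psm k; apply.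
Qed.

Let Cinf_induced : Cinf coordv U induced.
Proof.
move=> k; apply/(Ck_mxP _ _ _ oU) => a b.
under [X in Ck _ _ _ X]eq_fun do rewrite mxE sasakiE.
have at_mx (A : 'rV[R]_n -> 'M[R]_n) : Cinf coordv O A -> Ck coordv k U (fun y => A (bx y)).
  move=> hA; apply/(Ck_mxP _ _ _ oU) => i j; apply: (@Ck_at k (fun x => A x i j)) => m.
  by have /(Ck_mxP _ _ _ (metric_on_open Gm)) := hA m; apply.
have Gk := at_mx _ (metric_on_smooth Gm).
have Fk := at_mx _ (parallel_on_smooth Fm).
have sub (A : 'rV[R]_(n + n).-1 -> 'rV[R]_(n + n)) : Ck coordv k U A ->
    Ck coordv k U (fun y => lsubmx (A y)) /\ Ck coordv k U (fun y => rsubmx (A y)).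
  move=> /(Ck_mxP _ _ _ oU) hA; split; apply/(Ck_mxP _ _ _ oU) => i j;
    by under [X in Ck _ _ _ X]eq_fun do rewrite mxE.
have rowk c : Ck coordv k U (fun y => row c (J y)).
  apply/(Ck_mxP _ _ _ oU) => i j; under [X in Ck _ _ _ X]eq_fun do rewrite mxE.
  by have /(Ck_mxP _ _ _ oU) := Jsm k; apply.
have dotk (A B : 'rV[R]_(n + n).-1 -> 'rV[R]_n) : Ck coordv k U A -> Ck coordv k U B ->
    Ck coordv k U (fun y => dot (G (bx y)) (A y) (B y)).
  move=> hA hB; have := Ck_mulmx oU (Ck_mulmx oU hA Gk) (Ck_trmx oU hB).
  by move=> /(Ck_mxP _ _ _ oU); apply.
have vpk c : Ck coordv k U (fun y => vp (bx y) (fv y) (row c (J y))).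
  have [hl hr] := sub _ (rowk c); apply: Ck_add => //; apply: Ck_mulmx => //.
    by have [] := sub _ (Psm k).
  apply/(Ck_mxP _ _ _ oU) => i j; under [X in Ck _ _ _ X]eq_fun do rewrite mxE.
  apply: Ck_sum => // l _; apply: Ck_mul => //; first by move/(Ck_mxP _ _ _ oU): hl.
  exact: (@Ck_at k _ (Cinf_christoffel Gm l i j)).
apply: Ck_add => //; apply: dotk => //; first by have [] := sub _ (rowk a).
  by have [] := sub _ (rowk b).
exact: Ck_mulmx.
Qed.

Lemma induced_metric_on : metric_on induced U.
Proof.
split=> // y Uy.
apply: dot_eqmx => a b; rewrite dot_trmx !inducedE !sasakiE; congr (_ + _).
  exact: (@dsym y).
by rewrite -[lsubmx (P y)]/(bx y) -self// dsym.
Qed.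

Let isd_vp (V : normedModType R) (c f : V -> 'rV[R]_n) (a : V -> 'rV[R]_(n + n)) t e dc df da :
  O (c t) -> is_derive t e c dc -> is_derive t e f df -> is_derive t e a da ->
  is_derive t e (fun s => vp (c s) (f s) (a s))
    (rsubmx da + (df *m om G (c t) (lsubmx (a t))
     + f t *m ('D_dc ((om G)^~ (lsubmx (a t))) (c t) + om G (c t) (lsubmx da)))).
Proof.
move=> Oc hc hf ha; apply: is_deriveDf; first exact: is_derive_rsubmx.
apply: is_derive_mulmx => //.
exact: (is_derive_om Gm (c := c) Oc hc (is_derive_lsubmx ha)).
Qed.

(** Stated for abstract derivatives [dva] and [dvb] of the vertical parts, so as to serve both the
    derivative in time and the one along a variation. *)
Let isd_sasaki (V : normedModType R) (c f : V -> 'rV[R]_n) (a b : V -> 'rV[R]_(n + n)) t e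
    dc da db dva dvb :
  O (c t) -> is_derive t e c dc ->
  is_derive t e a da -> is_derive t e b db ->
  is_derive t e (fun s => vp (c s) (f s) (a s)) dva ->
  is_derive t e (fun s => vp (c s) (f s) (b s)) dvb ->
  is_derive t e (fun s => dot (G (c s)) (lsubmx (a s)) (lsubmx (b s))
     + dot (G (c s)) (vp (c s) (f s) (a s)) (vp (c s) (f s) (b s) *m F (c s)))
    (dot (G (c t)) (lsubmx da + lsubmx (a t) *m om G (c t) dc) (lsubmx (b t))
     + dot (G (c t)) (lsubmx (a t)) (lsubmx db + lsubmx (b t) *m om G (c t) dc)
     + (dot (G (c t)) (dva + vp (c t) (f t) (a t) *m om G (c t) dc) (vp (c t) (f t) (b t) *m F (c t))
     + dot (G (c t)) (vp (c t) (f t) (a t)) ((dvb + vp (c t) (f t) (b t) *m om G (c t) dc) *m F (c t)))).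
Proof.
move=> Oc hc ha hb hva hvb.
have hl := is_derive_lsubmx ha; have hl' := is_derive_lsubmx hb.
apply: is_deriveDf; first exact: (dmetric (c := c) Oc hc hl hl').
have hF := is_derive_endo Fm (c := c) Oc hc hvb.
by have := dmetric (c := c) Oc hc hva hF; rewrite subrK.
Qed.

(** * The geodesic equations in terms of base curve and fibre vector *)

Section Geodesic.
Variables (T : set R) (u : R -> 'rV[R]_(n + n).-1).
Hypothesis oT : open T.
Hypothesis usm : smooth_curve_on T u.
Hypothesis uU : forall t, T t -> U (u t).
Hypothesis geo : forall t, T t -> cov_along induced u (derive1 u) t = 0.

(** Along the curve, [y] is x' and [E] is D v, the two parts of the velocity [z1]; [DDx] and [DE]
    below are D x' and D D v. *)
Let x t := bx (u t).
Let v t := fv (u t).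
Let u1 := derive1 u.
Let u2 := derive1 u1.
Let z1 t := u1 t *m J (u t).
Let y t := lsubmx (z1 t).
Let E t := vp (x t) (v t) (z1 t).

Let hu t : T t -> is_derive t 1 u (u1 t).
Proof. by move=> Tt; apply: derivable_is_derive; exact: (@usm 0%N t Tt). Qed.

Let hu1 t : T t -> is_derive t 1 u1 (u2 t).
Proof. by move=> Tt; apply: derivable_is_derive; exact: (@usm 1%N t Tt). Qed.

Let geoE t : T t -> u2 t + u1 t *m om induced (u t) (u1 t) = 0.
Proof. by move=> Tt; have := geo Tt; rewrite /cov_along christoffel_appE. Qed.

Let hz t : T t -> is_derive t 1 (fun s => P (u s)) (z1 t).
Proof.
move=> Tt; have := is_derive_comp (hu Tt) (Cinf_diff Psm (uU Tt)).
by rewrite (derive_jacobian Psm _ (uU Tt)).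
Qed.

Let hx t : T t -> is_derive t 1 x (y t).
Proof. by move=> Tt; apply: is_derive_lsubmx; exact: hz. Qed.

Let hv t : T t -> is_derive t 1 v (rsubmx (z1 t)).
Proof. by move=> Tt; apply: is_derive_rsubmx; exact: hz. Qed.

Let hJ t : T t -> is_derive t 1 (fun s => J (u s)) ('D_(u1 t) J (u t)).
Proof. by move=> Tt; exact: is_derive_comp (hu Tt) (Cinf_diff Jsm (uU Tt)). Qed.

Let dz1 t := u2 t *m J (u t) + u1 t *m 'D_(u1 t) J (u t).

Let hz1 t : T t -> is_derive t 1 z1 (dz1 t).
Proof. by move=> Tt; apply: is_derive_mulmx; [exact: hu1|exact: hJ]. Qed.

Let dE t := rsubmx (dz1 t) + (rsubmx (z1 t) *m om G (x t) (y t)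
   + v t *m ('D_(y t) ((om G)^~ (y t)) (x t) + om G (x t) (lsubmx (dz1 t)))).

Let xO t : T t -> O (x t). Proof. by move=> Tt; exact: PO (uU Tt). Qed.

Let hE t : T t -> is_derive t 1 E (dE t).
Proof. by move=> Tt; exact: (isd_vp (c := x) (xO Tt) (hx Tt) (hv Tt) (hz1 Tt)). Qed.

Let DDx t := lsubmx (dz1 t) + y t *m om G (x t) (y t).
Let DE t := dE t + E t *m om G (x t) (y t).

(* The energy of the variation s |-> u t + s w, differentiated in s and in t. *)
Let first_variation t w : T t ->
  let p := lsubmx (w *m J (u t)) in let q := vp (x t) (v t) (w *m J (u t)) in
  dot (G (x t)) (DDx t) p + dot (G (x t)) (DE t) (q *m F (x t))
  + dot (G (x t)) (E t) (v t *m rm G (x t) (y t) p *m F (x t)) = 0.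
Proof.
move=> Tt p q; have Ut := uU Tt; have Ox := xO Tt.
have Im := induced_metric_on.
set C := w *m 'D_(u1 t) J (u t).
have hw : is_derive t 1 (fun s => w *m J (u s)) C.
  by have := is_derive_mulmx (is_derive_cstf w t 1) (hJ Tt); rewrite mul0mx add0r.
have hq := isd_vp (c := x) Ox (hx Tt) (hv Tt) hw.
(* The time derivative of the product of u' with the fixed [w] is computed twice: [A] through the
   lifts, [A'] through the induced connection, where the geodesic equation removes the term in
   [u2]. *)
have A := isd_sasaki (c := x) Ox (hx Tt) (hz1 Tt) hw (hE Tt) hq.
have A' := is_derive_metric Im (c := u) Ut (hu Tt) (hu1 Tt) (is_derive_cstf w t 1).
have AE : (fun s => dot (induced (u s)) (u1 s) w) = fun s =>
    dot (G (x s)) (lsubmx (z1 s)) (lsubmx (w *m J (u s)))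
    + dot (G (x s)) (vp (x s) (v s) (z1 s)) (vp (x s) (v s) (w *m J (u s)) *m F (x s)).
  by apply/funext => s; rewrite inducedE sasakiE.
rewrite AE geoE// dot0l !add0r in A'.
have ha : is_derive (u t) w (fun s => u1 t *m J s) C.
  have := is_derive_mulmx (is_derive_cstf (u1 t) (u t) w) (isd_J w Ut).
  by rewrite mul0mx add0r (jacobian_derive_sym oU Psm).
have hva := isd_vp (c := bx) Ox (isd_bx w Ut) (isd_fv w Ut) ha.
have B := isd_sasaki (c := bx) Ox (isd_bx w Ut) ha ha hva hva.
have B' := is_derive_metric Im (c := id) Ut (is_derive_id (u t) w)
  (is_derive_cstf (u1 t) (u t) w) (is_derive_cstf (u1 t) (u t) w).
have BE : (fun s => dot (induced s) (u1 t) (u1 t)) = fun s =>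
    dot (G (bx s)) (lsubmx (u1 t *m J s)) (lsubmx (u1 t *m J s))
    + dot (G (bx s)) (vp (bx s) (fv s) (u1 t *m J s)) (vp (bx s) (fv s) (u1 t *m J s) *m F (bx s)).
  by apply/funext => s; rewrite inducedE sasakiE.
rewrite BE !add0r in B'.
have AA := etrans (esym (is_derive_derive A)) (is_derive_derive A').
have BB := etrans (esym (is_derive_derive B)) (is_derive_derive B').
have gs := metric_on_sym Gm Ox; have fs := parallel_on_self Fm Ox.
have comm := cov_comm Gm (v t) (y t) p (rsubmx (z1 t)) (rsubmx (w *m J (u t))) (lsubmx C) (rsubmx C) Ox.
rewrite (om_sym Im (u1 t) w Ut) in AA.
have is2 : dot (induced (u t)) (u1 t *m om induced (u t) w) (u1 t) =
    dot (induced (u t)) (u1 t) (u1 t *m om induced (u t) w).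
  by apply: dotC; exact: (metric_on_sym Im Ut).
rewrite is2 in BB.
have lC : lsubmx (w *m J (u t)) *m om G (x t) (y t) = y t *m om G (x t) p.
  exact: (om_sym Gm).
rewrite lC in AA.
have VA := variation_algebra gs fs AA BB.
(* Regroups the commutator of [cov_comm] as the difference of D q in time and D E along the
   variation. *)
have key (oy op D1 D2 oC : 'M[R]_n) (a b c d : 'rV[R]_n) :
    (d + c *m oy + a *m (D1 + oC) + a *m op *m oy + b *m op)
    - (d + b *m op + a *m (D2 + oC) + a *m oy *m op + c *m oy) =
    (d + (b *m op + a *m (D1 + oC)) + (c + a *m op) *m oy)
    - (d + (c *m oy + a *m (D2 + oC)) + (b + a *m oy) *m op).
  by rewrite !mulmxDl; mx_ring.
by apply: etrans VA; congr (_ + dot _ _ (_ *m _)); rewrite -comm; exact: key.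
Qed.

Let first_variation_perp t p q : T t -> dot (G (x t)) (v t) (q *m F (x t)) = 0 ->
  dot (G (x t)) (DDx t) p + dot (G (x t)) (DE t) (q *m F (x t))
  + dot (G (x t)) (E t) (v t *m rm G (x t) (y t) p *m F (x t)) = 0.
Proof.
move=> Tt h0; have [|w Ew] := @span (u t) p (q - v t *m om G (x t) p) (uU Tt).
  by rewrite subrK.
by have := first_variation w Tt; rewrite Ew /vp row_mxKl row_mxKr subrK.
Qed.

(** Test with q = 0. Self-adjointness of [F] and pair symmetry take [p] out of the curvature
    operator; antisymmetry and purity then give the operator its form R(E, phi v). *)
Let horizontal_part t : T t -> DDx t = y t *m rm G (x t) (E t) (v t *m F (x t)).
Proof.
move=> Tt; have Ox := xO Tt; apply: (dot_inj (metric_on_unit Gm Ox)) => p.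
have /eqP := @first_variation_perp t p 0 Tt (ltac:(by rewrite mul0mx dot0r)).
rewrite mul0mx dot0r addr0 addr_eq0 => /eqP ->.
rewrite -(dot_self Fm _ _ Ox) (dotC _ _ (metric_on_sym Gm Ox)).
rewrite (dot_rm_pair Gm _ _ _ _ Ox) (rmC Gm _ _ Ox) mulmxN dotNl opprK.
by rewrite (rm_pure Gm Fm _ _ Ox).
Qed.

Let vertical_part t : T t -> exists l, DE t = l *: v t.
Proof.
move=> Tt; have Ox := xO Tt; exists (dot (G (x t)) (DE t) (v t *m F (x t))).
apply: perp_colinear.
- exact: (metric_on_unit Gm Ox).
- exact: FF.
- exact: (parallel_on_self Fm Ox).
- exact: P1 (uU Tt).
move=> q h0; have := first_variation_perp 0 Tt h0.
by rewrite dot0r add0r rm0r mulmx0 mul0mx dot0r addr0.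
Qed.

Hypothesis symm : forall x, O x -> forall p i j k l, cov_riemann G x p i j k l = 0.

(** All that is kept of the geodesic equation: the fibre vector has disappeared into [Q]. The clause
    on the derivative of [Q] is D Q = 0 in components, the connection acting on endomorphisms by
    commutator. *)
Lemma geodesic_skew (c X : R -> 'rV[R]_n) :
  (forall t, T t -> P (u t) = row_mx (c t) (X t)) ->
  exists Q : R -> 'M[R]_n, forall t, T t ->
    [/\ Q t *m G (c t) + G (c t) *m (Q t)^T = 0,
        is_derive t 1 Q (om G (c t) (derive1 c t) *m Q t - Q t *m om G (c t) (derive1 c t)) &
        cov_along G c (derive1 c) t = derive1 c t *m Q t].
Proof.
move=> PcX; have cE t : T t -> c t = x t by move=> Tt; rewrite /x /bx PcX// row_mxKl.
have near_T t (f h : R -> 'rV[R]_n) : T t -> (forall t, T t -> f t = h t) -> \near t, f t = h t.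
  by move=> Tt fh; exact: open_near oT Tt fh.
have c1E t : T t -> derive1 c t = y t.
  move=> Tt; rewrite derive1E; apply: is_derive_derive.
  by apply: near_eq_is_derive (hx Tt); apply: near_T Tt _ => s /cE.
have c2E t : T t -> derive1 (derive1 c) t = lsubmx (dz1 t).
  move=> Tt; rewrite derive1E; apply: is_derive_derive.
  apply: near_eq_is_derive (is_derive_lsubmx (hz1 Tt)).
  by apply: near_T Tt _ => s /c1E.
exists (fun t => rm G (x t) (E t) (v t *m F (x t))) => t Tt; have Ox := xO Tt.
rewrite /cov_along christoffel_appE c1E// c2E// cE//; split.
- exact: (rm_skew Gm _ _ Ox).
- have hvF := is_derive_endo Fm (c := x) Ox (hx Tt) (hv Tt).
  apply: is_derive_eq; first exact: (is_derive_rm Gm symm (c := x) Ox (hx Tt) (hE Tt) hvF).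
  rewrite subrK -/(DE t) -/(vp (x t) (v t) (z1 t)) -/(E t).
  have [l ->] := vertical_part Tt.
  by rewrite rmZl !(rm_diag Gm Fm _ Ox) scaler0 !add0r.
- exact: horizontal_part.
Qed.

End Geodesic.

End Hypersurface.

(** * Change of chart *)

(* By the Koszul formula, the connection of the pulled back metric is determined
   by a symmetric expression. *)
Lemma om_change (R : realType) n (Gc Gd : 'rV[R]_n -> 'M[R]_n) (W Od : set 'rV[R]_n)
    (T : 'rV[R]_n -> 'rV[R]_n) (p u v : 'rV[R]_n) :
  metric_on Gc W -> metric_on Gd Od -> Cinf coordv W T ->
  (forall x, W x -> Od (T x)) ->
  (forall x, W x -> Gc x = jacobian T x *m Gd (T x) *m (jacobian T x)^T) ->
  W p ->
  v *m om Gc p u *m jacobian T p =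
    v *m 'D_u (jacobian T) p + v *m jacobian T p *m om Gd (T p) (u *m jacobian T p).
Proof.
move=> mc md Tsm WO GE Wp; have oW := metric_on_open mc.
set J := jacobian T.
have Ju : J p \in unitmx.
  have := metric_on_unit mc Wp; rewrite GE// unitmx_mul => /andP[].
  by rewrite unitmx_mul => /andP[].
(* [Phi] is the expected pullback connection. It is symmetric because second derivatives of [T]
   commute, and [dG] makes it compatible with the pulled back metric; Koszul's formula then forces
   the equality. *)
pose Phi (a b : 'rV[R]_n) := b *m 'D_a J p + b *m J p *m om Gd (T p) (a *m J p).
have PhiC a b : Phi a b = Phi b a.
  by rewrite /Phi (jacobian_derive_sym oW Tsm a b Wp) (om_sym md _ _ (WO _ Wp)).
have dG a b w : dot ('D_a Gc p) b w =
    dot (Gd (T p)) (Phi a b) (w *m J p) + dot (Gd (T p)) (b *m J p) (Phi a w).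
  have hT : is_derive p a T (a *m J p).
    by rewrite -(derive_jacobian Tsm a Wp); exact: Cinf_is_derive Tsm Wp.
  have hJ (z : 'rV[R]_n) : is_derive p a (fun x => z *m J x) (z *m 'D_a J p).
    have := is_derive_mulmx (is_derive_cstf z p a) (Cinf_is_derive a (Cinf_jacobian oW Tsm) Wp).
    by rewrite mul0mx add0r.
  have h1 := is_derive_metric md (c := T) (WO _ Wp) hT (hJ b) (hJ w).
  have h2 := is_derive_dot (Cinf_is_derive a (metric_on_smooth mc) Wp)
     (is_derive_cstf b p a) (is_derive_cstf w p a).
  rewrite dot0l dot0r !addr0 in h2.
  rewrite -(is_derive_derive h2); apply: (derive_on oW Wp _ h1) => x Wx.
  by rewrite GE// dot_mulr dot_mull.
have key w : dot (Gd (T p)) (v *m om Gc p u *m J p) (w *m J p) =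
    dot (Gd (T p)) (Phi u v) (w *m J p).
  have -> : dot (Gd (T p)) (v *m om Gc p u *m J p) (w *m J p) = dot (Gc p) (v *m om Gc p u) w.
    by rewrite GE// dot_mulr dot_mull.
  have := koszul mc u v w Wp; rewrite !dG (PhiC v u) (PhiC w u) (PhiC w v).
  have gs := metric_on_sym md (WO _ Wp).
  rewrite (dotC (Phi u w) (v *m J p) gs).
  move: (dot _ _ _) (dot _ _ _) (dot _ _ _) (dot _ _ _) => x1 x2 x3 x4 e.
  by lra.
apply: (dot_inj (metric_on_unit md (WO _ Wp))) => w.
by rewrite -[w](mulmxKV Ju) key.
Qed.

Section Curves.
Context {R : realType}.

Definition dir1 (_ : unit) : R := 1.

Lemma smooth_curve_onP (W : normedModType R) (T : set R) (f : R -> W) :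
  smooth_curve_on T f <-> Cinf dir1 T f.
Proof.
have E (h : R -> W) : 'D_1 h = derive1 h by apply/funext => t; rewrite derive1E.
split=> [hf k|hf k t Tt].
  elim: k f hf => [|k IH] f hf; split => //.
  - by move=> t Tt; apply/derivable1_diffP; exact: (hf 0%N).
  - by move=> t Tt; apply/derivable1_diffP; exact: (hf 0%N).
  by move=> []; rewrite /dir1 E; apply: IH => m t Tt; have := hf m.+1 t Tt; rewrite derive1Sn.
elim: k f hf => [|k IH] f hf; first by apply/derivable1_diffP; exact: Ck_diff (hf 0%N) Tt.
by rewrite derive1Sn; apply: IH; rewrite -E; exact: (Cinf_derive tt hf).
Qed.

Lemma smooth_curve_is_derive (W : normedModType R) (T : set R) (f : R -> W) t :
  smooth_curve_on T f -> T t -> is_derive t 1 f (derive1 f t).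
Proof. by move=> h Tt; apply: derivable_is_derive; exact: (h 0%N). Qed.

Lemma smooth_curve_derive1 (W : normedModType R) (T : set R) (f : R -> W) :
  smooth_curve_on T f -> smooth_curve_on T (derive1 f).
Proof. by move=> h k t Tt; have := h k.+1 t Tt; rewrite derive1Sn. Qed.

Lemma smooth_cov_along n (G : 'rV[R]_n -> 'M[R]_n) (O : set 'rV[R]_n) (T : set R) (c X : R -> 'rV[R]_n) :
  metric_on G O -> open T -> (forall t, T t -> O (c t)) ->
  smooth_curve_on T c -> smooth_curve_on T X -> smooth_curve_on T (cov_along G c X).
Proof.
move=> Gm oT cO hc hX; apply/smooth_curve_onP => k.
have C f : smooth_curve_on T f -> Ck dir1 k T (f : R -> 'rV[R]_n) by move=> /smooth_curve_onP.
have Ec : cov_along G c X = fun t => derive1 X t + X t *m om G (c t) (derive1 c t).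
  by apply/funext => t; rewrite /cov_along christoffel_appE.
rewrite Ec; apply: Ck_add => //; first exact: C (smooth_curve_derive1 hX).
apply: Ck_mulmx => //; first exact: C.
apply/(Ck_mxP _ _ _ oT) => i j; under [X in Ck _ _ _ X]eq_fun do rewrite mxE.
apply: Ck_sum => // l _; apply: Ck_mul => //.
  by have /(Ck_mxP _ _ _ oT) := C _ (smooth_curve_derive1 hc); apply.
exact: (Ck_comp oT cO (C _ hc) (@Cinf_christoffel _ _ _ _ Gm l i j k)).
Qed.

Lemma smooth_curve_lin n (T : set R) (a b : R) (X Y : R -> 'rV[R]_n) : open T ->
  smooth_curve_on T X -> smooth_curve_on T Y ->
  smooth_curve_on T (fun t => a *: X t + b *: Y t).
Proof.
move=> oT /smooth_curve_onP hX /smooth_curve_onP hY; apply/smooth_curve_onP => k.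
have sc d (Z : R -> 'rV[R]_n) : Ck dir1 k T Z -> Ck dir1 k T (fun t => d *: Z t).
  move=> /(Ck_mxP _ _ _ oT) hZ; apply/(Ck_mxP _ _ _ oT) => i j.
  under [X in Ck _ _ _ X]eq_fun do rewrite mxE.
  by apply: Ck_mul => //; exact: Ck_cst.
by apply: Ck_add => //; apply: sc.
Qed.

Lemma interval_cst (I : set R) (f : R -> R) : is_interval I ->
  (forall t, I t -> is_derive t 1 f 0) -> forall s t, I s -> I t -> f s = f t.
Proof.
move=> iI df.
suff lt s t : I s -> I t -> s <= t -> f s = f t.
  by move=> s t Is It; have [/lt|/ltW/lt] := leP s t => [|/(_ It Is)]; [exact|].
move=> Is It st.
have sub x : x \in `[s, t] -> I x.
  by rewrite in_itv/= => /andP[sx xt]; apply: (iI s t) => //; rewrite sx.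
have [||z _] := @MVT_segment R f (fun=> 0) s t st.
- by move=> x /subset_itv_oo_cc /sub; exact: df.
- by apply: derivable_within_continuous => x /sub/df [].
- by rewrite mul0r => /eqP; rewrite subr_eq0 => /eqP.
Qed.

End Curves.

(** * Fields along a curve and their independence of the chart *)

Section Manifold.
Context {R : realType} {n : nat} {M : topologicalType}.
Variables (A : set (chart R n M)) (g : components R n M).
Hypothesis Mm : smooth_manifold A.
Hypothesis gm : riemannian_metric A g.
Variables (I : set R) (gamma : R -> M).
Hypothesis oI : open I.
Hypothesis gsm : smooth_curve A I gamma.
Implicit Types (c d : chart R n M) (X Y : fieldtype R n M).

Lemma chart_metric_on c : A c -> metric_on (g c) (chart_img c).
Proof.
move=> Ac; have [_ _ hc _ _] := Mm; have [gs _ gp] := gm.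
split.
- by have [] := hc _ Ac.
- by apply/smooth_onP; exact: gs.
- by move=> x /(gp c x Ac)[].
move=> x /(gp c x Ac)[gsy pos]; rewrite -row_free_unit -kermx_eq0; apply/rowV0P => v /sub_kermxP v0.
apply/eqP/negP => /negP /pos; by rewrite /dot v0 mul0mx mxE ltxx.
Qed.

Lemma overlap_smooth c d : A c -> A d ->
  open (chart_map c @` (chart_dom c `&` chart_dom d)) /\
  Cinf coordv (chart_map c @` (chart_dom c `&` chart_dom d)) (transition c d).
Proof.
move=> Ac Ad; have [_ _ hc _ sm] := Mm; split; last by apply/smooth_onP; exact: sm.
have [_ oi can _ ci] := hc _ Ac; have [od _ _ _ _] := hc _ Ad.
have -> : chart_map c @` (chart_dom c `&` chart_dom d) =
    chart_img c `&` chart_inv c @^-1` chart_dom d.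
  apply/seteqP; split => [_ [x [xc xd] <-]|p [[x xc <-] xd]] /=.
    by split; [exists x|rewrite /= can// inE].
  by exists x => //; split => //; move: xd; rewrite /= can// inE.
move: ci; rewrite continuous_open_subspace// => /(continuous_inP _ oi); exact.
Qed.

Lemma chart_imgE c t : A c -> chart_dom c (gamma t) -> chart_img c (coords c gamma t).
Proof. by move=> Ac ct; exists (gamma t). Qed.

Lemma chart_time_open c : A c -> open (I `&` gamma @^-1` chart_dom c).
Proof.
move=> Ac; have [_ _ hc _ _] := Mm; have [od _ _ _ _] := hc _ Ac; have [gc _] := gsm.
have /(continuous_inP _ oI) : {in I, continuous gamma} by move=> t /[!inE]; exact: gc.
exact.
Qed.

Lemma transition_coords c d x : A c -> chart_dom c x ->
  transition c d (chart_map c x) = chart_map d x.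
Proof.
by move=> Ac cx; have [_ _ /(_ _ Ac)[_ _ can _ _] _ _] := Mm; rewrite /transition/= can// inE.
Qed.

Lemma coords_is_derive c t : A c -> I t -> chart_dom c (gamma t) ->
  is_derive t 1 (coords c gamma) (velocity gamma c t).
Proof. by move=> Ac It ct; have [_ /(_ c Ac) h] := gsm; exact: (smooth_curve_is_derive h). Qed.

Lemma field_is_derive X c t : field_along A I gamma X -> A c -> I t -> chart_dom c (gamma t) ->
  is_derive t 1 (X c) (derive1 (X c) t).
Proof. by move=> [/(_ c) h _] Ac It ct; exact: (smooth_curve_is_derive (h Ac)). Qed.

Lemma covdE X c t : covd g gamma X c t =
  derive1 (X c) t + X c t *m om (g c) (coords c gamma t) (velocity gamma c t).
Proof. by rewrite /covd /cov_along christoffel_appE. Qed.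

Let near_overlap c d t (P : R -> Prop) : A c -> A d -> I t ->
  chart_dom c (gamma t) -> chart_dom d (gamma t) ->
  (forall s, I s -> chart_dom c (gamma s) -> chart_dom d (gamma s) -> P s) ->
  \forall s \near t, P s.
Proof.
move=> Ac Ad It ct dt h.
have nc := open_nbhs_nbhs (conj (chart_time_open Ac) (conj It ct)).
have nd := open_nbhs_nbhs (conj (chart_time_open Ad) (conj It dt)).
by near=> s; have [|Is cs] := near nc s => //; have [|_ ds] := near nd s => //; exact: h.
Unshelve. all: by end_near. Qed.

Lemma velocity_change c d t : A c -> A d -> I t ->
  chart_dom c (gamma t) -> chart_dom d (gamma t) ->
  velocity gamma d t = velocity gamma c t *m change c d (gamma t).
Proof.
move=> Ac Ad It ct dt; have [oW Tsm] := overlap_smooth Ac Ad.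
have Wt : (chart_map c @` (chart_dom c `&` chart_dom d)) (coords c gamma t) by exists (gamma t).
have h := is_derive_comp (coords_is_derive Ac It ct) (Cinf_diff Tsm Wt).
rewrite (derive_jacobian Tsm _ Wt) in h.
rewrite /velocity derive1E; apply: is_derive_derive; apply: near_eq_is_derive h.
by apply: (near_overlap Ac Ad It ct dt) => s _ cs _; rewrite transition_coords.
Qed.

(** Differentiating the transformation law of [X] produces a derivative of the Jacobian, which is
    exactly the inhomogeneous term in [om_change]. *)
Lemma covd_change X c d t : field_along A I gamma X -> A c -> A d -> I t ->
  chart_dom c (gamma t) -> chart_dom d (gamma t) ->
  covd g gamma X d t = covd g gamma X c t *m change c d (gamma t).
Proof.
move=> hX Ac Ad It ct dt; have [oW Tsm] := overlap_smooth Ac Ad.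
set W := chart_map c @` _ in oW Tsm.
have Wt : W (coords c gamma t) by exists (gamma t).
have hc := coords_is_derive Ac It ct.
have hXd : is_derive t 1 (X d) (derive1 (X c) t *m change c d (gamma t)
    + X c t *m 'D_(velocity gamma c t) (jacobian (transition c d)) (coords c gamma t)).
  have hJ := is_derive_comp hc (Cinf_diff (Cinf_jacobian oW Tsm) Wt).
  apply: near_eq_is_derive (is_derive_mulmx (field_is_derive hX Ac It ct) hJ).
  apply: (near_overlap Ac Ad It ct dt) => s Is cs ds.
  by have [_ /(_ c d s Ac Ad Is cs ds)] := hX.
rewrite !covdE (velocity_change Ac Ad It ct dt) derive1E (is_derive_derive hXd).
have mc : metric_on (g c) W.
  have [_ h2 h3 h4] := chart_metric_on Ac; have sub x : W x -> chart_img c x.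
    by move=> [z [cz _] <-]; exists z.
  split => // [k|x /sub/h3//|x /sub/h4//].
  exact: Ck_subset sub (h2 k).
have md := chart_metric_on Ad.
have WO x : W x -> chart_img d (transition c d x).
  by move=> [z [cz dz] <-]; rewrite transition_coords//; exists z.
have GE x : W x -> g c x = jacobian (transition c d) x *m g d (transition c d x)
    *m (jacobian (transition c d) x)^T.
  move=> [z [cz dz] <-]; rewrite transition_coords//.
  by have [_ /(_ c d z Ac Ad cz dz) -> _] := gm.
have [_ /(_ c d t Ac Ad It ct dt) -> ] := hX.
rewrite mulmxDl (om_change _ _ mc md Tsm WO GE Wt) [transition c d _]transition_coords//.
by rewrite addrA.
Qed.

Lemma inner_change X Y c d t : field_along A I gamma X -> field_along A I gamma Y ->
  A c -> A d -> I t -> chart_dom c (gamma t) -> chart_dom d (gamma t) ->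
  inner g gamma X Y c t = inner g gamma X Y d t.
Proof.
move=> [_ hX] [_ hY] Ac Ad It ct dt; rewrite /inner (hX c d)// (hY c d)// /coords/=.
by have [_ /(_ c d _ Ac Ad ct dt) -> _] := gm; rewrite dot_mulr dot_mull.
Qed.

Lemma velocity_field : field_along A I gamma (velocity gamma).
Proof.
split; last by move=> c d t; exact: velocity_change.
by move=> c Ac; have [_ /(_ c Ac) h] := gsm; exact: smooth_curve_derive1.
Qed.

Lemma covd_field X : field_along A I gamma X -> field_along A I gamma (covd g gamma X).
Proof.
move=> hX; split; last by move=> c d t; exact: covd_change.
move=> c Ac; have [_ /(_ c Ac) h] := gsm; have [/(_ c Ac) hXc _] := hX.
apply: (smooth_cov_along (chart_metric_on Ac)) => //; first exact: chart_time_open.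
by move=> t [_ ct]; exact: chart_imgE.
Qed.

(** The coefficients are constants, so that the combination commutes with [covd]. *)
Definition linf (a b : R) X Y : fieldtype R n M := fun c t => a *: X c t + b *: Y c t.

Lemma linf_field a b X Y : field_along A I gamma X -> field_along A I gamma Y ->
  field_along A I gamma (linf a b X Y).
Proof.
move=> [X1 X2] [Y1 Y2]; split.
  by move=> c Ac; apply: smooth_curve_lin; [exact: chart_time_open|exact: X1|exact: Y1].
by move=> c d t Ac Ad It ct dt; rewrite /linf (X2 c d)// (Y2 c d)// mulmxDl !scalemxAl.
Qed.

Lemma covd_linf a b X Y c t : field_along A I gamma X -> field_along A I gamma Y ->
  A c -> I t -> chart_dom c (gamma t) ->
  covd g gamma (linf a b X Y) c t = a *: covd g gamma X c t + b *: covd g gamma Y c t.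
Proof.
move=> hX hY Ac It ct; rewrite !covdE /linf.
have dX := is_derive_scale (is_derive_cstf a t 1) (field_is_derive hX Ac It ct).
have dY := is_derive_scale (is_derive_cstf b t 1) (field_is_derive hY Ac It ct).
rewrite derive1E (is_derive_derive (is_deriveDf dX dY)) !scale0r !add0r mulmxDl -!scalemxAl.
by rewrite !scalerDr addrACA.
Qed.

Lemma inner_is_derive X Y c t : field_along A I gamma X -> field_along A I gamma Y ->
  A c -> I t -> chart_dom c (gamma t) ->
  is_derive t 1 (inner g gamma X Y c)
    (inner g gamma (covd g gamma X) Y c t + inner g gamma X (covd g gamma Y) c t).
Proof.
move=> hX hY Ac It ct; rewrite /inner !covdE.
apply: (is_derive_metric (chart_metric_on Ac) (c := coords c gamma)).
- exact: chart_imgE.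
- exact: coords_is_derive.
- exact: field_is_derive.
- exact: field_is_derive.
Qed.

Lemma inner_linl a b X Y Z c t : inner g gamma (linf a b X Y) Z c t =
  a * inner g gamma X Z c t + b * inner g gamma Y Z c t.
Proof. by rewrite /inner dotDl !dotZl. Qed.

Lemma innerC X Y c t : A c -> chart_dom c (gamma t) ->
  inner g gamma X Y c t = inner g gamma Y X c t.
Proof.
move=> Ac ct; apply: dotC; exact: (metric_on_sym (chart_metric_on Ac) (chart_imgE Ac ct)).
Qed.

Lemma inner_eq0 X c t : A c -> chart_dom c (gamma t) ->
  inner g gamma X X c t = 0 -> X c t = 0.
Proof.
move=> Ac ct h; apply/eqP/negP => /negP X0; have [_ _ /(_ c _ Ac (chart_imgE Ac ct))[_]] := gm.
by move=> /(_ _ X0); rewrite [dot _ _ _]h ltxx.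
Qed.

End Manifold.

(** * Frenet curvatures *)

Section Rotation.
Context {R : realType} {n : nat} {M : topologicalType}.
Variables (A : set (chart R n M)) (g phi : components R n M).
Variables (I : set R) (gamma : R -> M) (xi : fieldtype R n M).
Hypothesis pkn : para_kahler_norden A g phi.
Hypothesis symm : locally_symmetric A g.
Hypothesis oI : open I.
Hypothesis iI : is_interval I.
Hypothesis geo : geodesic_T1 A g phi I gamma xi.
Implicit Types (c d : chart R n M) (X Y Z : fieldtype R n M).

Let Mm : smooth_manifold A. Proof. by case: pkn. Qed.
Let gm : riemannian_metric A g. Proof. by case: pkn. Qed.
Let gsm : smooth_curve A I gamma. Proof. by case: geo => -[]. Qed.

Local Notation D := (covd g gamma).
Local Notation ip := (inner g gamma).
Local Notation vel := (@velocity R n M gamma).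

Definition rotating c (T : set R) (Q : R -> 'M[R]_n) :=
  [/\ A c, open T, forall t, T t -> I t /\ chart_dom c (gamma t) &
      forall t, T t ->
      [/\ Q t *m g c (coords c gamma t) + g c (coords c gamma t) *m (Q t)^T = 0,
          is_derive t 1 Q (om (g c) (coords c gamma t) (velocity gamma c t) *m Q t
                           - Q t *m om (g c) (coords c gamma t) (velocity gamma c t)) &
          covd g gamma (velocity gamma) c t = velocity gamma c t *m Q t]].

Lemma chart_parallel_on c : A c ->
  parallel_on (g c) (phi c) (chart_img c) /\
  forall x, chart_img c x -> phi c x *m phi c x = 1%:M.
Proof.
move=> Ac; have [_ _ [ps _] _ hp] := pkn; split; last by move=> x /(hp c x Ac)[].
split; first by apply/smooth_onP; exact: ps.
  move=> x /(hp c x Ac)[_ _ sf _]; apply: dot_eqmx => u v.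
  by rewrite dot_mull dot_mulr.
by move=> x /(hp c x Ac)[].
Qed.

Lemma geodesic_rotating t0 : I t0 -> exists c T Q, T t0 /\ rotating c T Q.
Proof.
move=> It0; have [_ /(_ t0 It0)[c [T [U [P [u [Ac [oT Tt0] [oU Psm _ Pfree PT1] usm hT]]]]]]] := geo.
have [pc ff] := chart_parallel_on Ac.
have [|||||||Q hQ] := @geodesic_skew R n (g c) (phi c) (chart_img c) (chart_metric_on Mm gm Ac) pc ff
  U P oU _ Pfree _ _ T u oT usm _ _ _ (coords c gamma) (xi c).
- by apply/smooth_onP.
- by move=> y /PT1[].
- by move=> y /PT1[].
- by move=> t /hT[].
- by move=> t /hT[].
- by move=> x; exact: symm.
- by move=> t /hT[].
exists c, T, Q; split => //; split => //; first by move=> t /hT[].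
Qed.

(** Quantifying over every local triple avoids having to glue the operators [Q] obtained from
    different parametrizations. *)
Definition rotated_field X := field_along A I gamma X /\
  forall c T Q, rotating c T Q -> forall t, T t -> D X c t = X c t *m Q t.

Lemma rotated_field_along X : rotated_field X -> field_along A I gamma X.
Proof. by case. Qed.

Lemma rotated_field_velocity : rotated_field vel.
Proof.
split; first exact: (velocity_field Mm oI gsm).
by move=> c T Q [_ _ _ h] t /h[].
Qed.

Lemma rotated_field_linf a b X Y : rotated_field X -> rotated_field Y -> rotated_field (linf a b X Y).
Proof.
move=> [fX hX] [fY hY]; split; first exact: (linf_field Mm oI gsm).
move=> c T Q hr t Tt; have [Ac _ /(_ t Tt)[It ct] _] := hr.
rewrite (covd_linf _ _ _ fX fY Ac It ct) (hX c T Q hr t Tt) (hY c T Q hr t Tt).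
by rewrite mulmxDl -!scalemxAl.
Qed.

(** Since [Q] is parallel, differentiating D X = X Q gives D (D X) = (D X) Q. *)
Lemma rotated_field_covd X : rotated_field X -> rotated_field (D X).
Proof.
move=> [fX hX]; split; first exact: (covd_field Mm gm oI gsm).
move=> c T Q hr t Tt; have [Ac oT TI h] := hr; have [It ct] := TI t Tt.
have [_ hQ _] := h t Tt.
have hp := is_derive_mulmx (field_is_derive fX Ac It ct) hQ.
have hd : is_derive t 1 (D X c) (derive1 (X c) t *m Q t + X c t *m
   (om (g c) (coords c gamma t) (velocity gamma c t) *m Q t
    - Q t *m om (g c) (coords c gamma t) (velocity gamma c t))).
  apply: near_eq_is_derive hp; apply: (open_near oT Tt) => s Ts.
  by rewrite (hX c T Q hr s Ts).
have E := hX c T Q hr t Tt; rewrite covdE in E.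
rewrite covdE derive1E (is_derive_derive hd) (hX c T Q hr t Tt) -[in RHS]E.
by rewrite mulmxDl mulmxBr !mulmxA addrA subrK.
Qed.

Lemma rotated_field_skew X Y c T Q t : rotated_field X -> rotated_field Y -> rotating c T Q -> T t ->
  ip (D X) Y c t + ip X (D Y) c t = 0.
Proof.
move=> [fX hX] [fY hY] hr Tt; have [Ac oT TI h] := hr; have [qs _ _] := h t Tt.
rewrite /inner (hX c T Q hr t Tt) (hY c T Q hr t Tt) -dot_mull -dot_mulr -dotD qs.
by rewrite /dot mulmx0 mul0mx mxE.
Qed.

Lemma chart_at t : exists c, A c /\ chart_dom c (gamma t).
Proof. by have [_ _ _ /(_ (gamma t))[c Ac ct] _] := Mm; exists c. Qed.

Lemma rotated_field_inner X Y c d s t : rotated_field X -> rotated_field Y -> A c -> A d -> I s -> I t ->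
  chart_dom c (gamma s) -> chart_dom d (gamma t) -> ip X Y c s = ip X Y d t.
Proof.
move=> KX KY Ac Ad Is It cs dt; have [fX _] := KX; have [fY _] := KY.
(* A chart chosen at each time turns the product into one function on [I]; near each time it agrees
   with its expression in a single chart, where skewness of [Q] makes its derivative vanish. *)
have [C hC] := choice chart_at.
pose f t := ip X Y (C t) t.
have fE e u : A e -> I u -> chart_dom e (gamma u) -> f u = ip X Y e u.
  by move=> Ae Iu eu; have [ACu Cu] := hC u; exact: (inner_change gm fX fY ACu Ae Iu Cu eu).
rewrite -(fE c s)// -(fE d t)//; apply: (interval_cst iI) => // u Iu.
have [e [T [Q [Tu hr]]]] := geodesic_rotating Iu; have [Ae oT TI _] := hr.
have [_ eu] := TI u Tu.
have hd := inner_is_derive Mm gm gsm fX fY Ae Iu eu.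
rewrite [X in is_derive _ _ _ X](_ : _ = 0) in hd; last exact: (rotated_field_skew KX KY hr Tu).
apply: near_eq_is_derive hd; apply: (open_near oT Tu) => v /TI[Iv ev].
by rewrite (fE e v).
Qed.

(** [rotated_field_skew] is tied to the chart of a local [Q]; invariance of the inner products
    carries it to any chart. *)
Lemma rotated_field_skewE X Y c t : rotated_field X -> rotated_field Y -> A c -> I t -> chart_dom c (gamma t) ->
  ip (D X) Y c t = - ip X (D Y) c t.
Proof.
move=> KX KY Ac It ct.
have [e [T [Q [Tt hr]]]] := geodesic_rotating It; have [Ae oT TI _] := hr.
have [_ et] := TI t Tt.
have KDX := rotated_field_covd KX; have KDY := rotated_field_covd KY.
rewrite (rotated_field_inner KDX KY Ac Ae It It ct et) (rotated_field_inner KX KDY Ac Ae It It ct et).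
by apply/eqP; rewrite -addr_eq0 (rotated_field_skew KX KY hr Tt).
Qed.

Lemma covd_ext X Y c t : (forall s, I s -> chart_dom c (gamma s) -> X c s = Y c s) ->
  A c -> I t -> chart_dom c (gamma t) -> D X c t = D Y c t.
Proof.
move=> XY Ac It ct; rewrite (covdE g gamma X) (covdE g gamma Y) (XY t It ct); congr (_ + _).
rewrite (derive1E (X c)) (derive1E (Y c)).
by apply: near_eq_derive; apply: (open_near (chart_time_open Mm oI gsm Ac)) => // s [Is cs]; exact: XY.
Qed.

Lemma rotated_field_ext X Y : field_along A I gamma Y ->
  (forall c t, A c -> I t -> chart_dom c (gamma t) -> Y c t = X c t) -> rotated_field X -> rotated_field Y.
Proof.
move=> fY YX [_ hX]; split => // c T Q hr t Tt.
have [Ac _ /(_ t Tt)[It ct] _] := hr.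
rewrite (@covd_ext Y X c t)//; last by move=> s Is cs; exact: YX.
by rewrite (hX c T Q hr t Tt) YX.
Qed.

Section Frenet.
Variables (c0 : chart R n M) (t0 : R).
Hypothesis Ac0 : A c0.
Hypothesis It0 : I t0.
Hypothesis ct0 : chart_dom c0 (gamma t0).
Hypothesis speed0 : speed g gamma c0 t0 != 0.

Local Notation b X Y := (ip X Y c0 t0).
Local Notation sp := (speed g gamma c0 t0).

Let bE X Y c t : rotated_field X -> rotated_field Y -> A c -> I t -> chart_dom c (gamma t) ->
  ip X Y c t = b X Y.
Proof. by move=> KX KY Ac It ct; exact: rotated_field_inner. Qed.

(** The velocity is a rotated field, so the speed is constant, and being nonzero at [t0] makes the
    whole curve regular. *)
Let speedE c t : A c -> I t -> chart_dom c (gamma t) -> speed g gamma c t = sp.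
Proof.
by move=> Ac It ct; rewrite /speed (bE rotated_field_velocity rotated_field_velocity Ac It ct).
Qed.

Let b_vel : b vel vel = sp ^+ 2.
Proof.
rewrite /speed sqr_sqrtr// /inner.
have [-> |v0] := eqVneq (velocity gamma c0 t0) 0; first by rewrite dot0l.
by have [_ _ /(_ c0 _ Ac0 (chart_imgE Ac0 ct0))[_ /(_ _ v0)/ltW]] := gm.
Qed.

(** * Constancy of the curvatures of any given Frenet frame *)

Section Uniqueness.
Variables (r : nat) (nu : nat -> fieldtype R n M) (k : nat -> R -> R).
Hypothesis fr : frenet A g I gamma r nu k.

(* On the class of rotated fields the Frenet equation for nu i reads
   W = k i *: nu i.+1 with W in the class, so k i ^+ 2 is constant; then k i itself is
   constant because W and its derivative are orthogonal. *)
Let frenet_step i (W : fieldtype R n M) : (0 < i < r)%N -> rotated_field W ->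
  (forall c t, A c -> I t -> chart_dom c (gamma t) -> W c t = k i t *: nu i.+1 c t) ->
  rotated_field (nu i.+1) /\ exists kappa, forall t, I t -> k i t = kappa.
Proof.
move=> /andP[i0 ir] KW WE; have [_ _ fnu [nz _] eqs] := fr.
have fW := rotated_field_along KW; have fnu1 : field_along A I gamma (nu i.+1) by exact: fnu.
have unit c t : A c -> I t -> chart_dom c (gamma t) -> ip (nu i.+1) (nu i.+1) c t = 1.
  by move=> Ac It ct; have [/(_ i.+1 i.+1) -> //] := eqs c t Ac It ct; rewrite eqxx.
have WW c t : A c -> I t -> chart_dom c (gamma t) -> ip W W c t = k i t ^+ 2.
  by move=> Ac It ct; rewrite /inner WE// dotZl dotZr [dot _ _ _]unit// mulr1 expr2.
have Wnu c t : A c -> I t -> chart_dom c (gamma t) -> ip W (nu i.+1) c t = k i t.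
  by move=> Ac It ct; rewrite /inner WE// dotZl [dot _ _ _]unit// mulr1.
have k2 t : I t -> k i t ^+ 2 = b W W.
  by move=> It; have [c [Ac ct]] := chart_at t; rewrite -(WW c t)//; exact: bE.
have kn0 t : I t -> k i t != 0.
  move=> It; have [s Is ks] := nz i (introT andP (conj i0 ir)).
  by apply: contraNN ks => /eqP kt; rewrite -sqrf_eq0 k2// -(k2 t)// kt expr0n.
(* [nu i.+1] is not yet known to be rotated, so [rotated_field_inner] cannot be applied to k i = ip
   W (nu i.+1). Both terms of its derivative vanish: [nu i.+1] is a unit field, and D W is
   orthogonal to [W], a nonzero multiple of [nu i.+1]. *)
have kc s t : I s -> I t -> k i s = k i t.
  apply: (interval_cst iI) => u Iu; have [c [Ac cu]] := chart_at u.
  have nW := open_near (chart_time_open Mm oI gsm Ac) (conj Iu cu).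
  have hd := inner_is_derive Mm gm gsm fW fnu1 Ac Iu cu.
  have hn := inner_is_derive Mm gm gsm fnu1 fnu1 Ac Iu cu.
  have hn0 : is_derive u 1 (ip (nu i.+1) (nu i.+1) c) 0.
    apply: near_eq_is_derive (is_derive_cstf (1 : R) u 1); apply: nW => s' [Is' cs'].
    by rewrite unit.
  have nn : ip (nu i.+1) (D (nu i.+1)) c u = 0.
    have := etrans (esym (is_derive_derive hn)) (is_derive_derive hn0).
    rewrite (innerC Mm gm (D _) _ Ac cu); move: (ip _ _ _ _) => z; lra.
  have DW : ip (D W) (nu i.+1) c u = 0.
    have : ip (D W) W c u = 0.
      have := rotated_field_skewE KW KW Ac Iu cu; rewrite (innerC Mm gm W _ Ac cu).
      by move: (ip _ _ _ _) => z; lra.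
    rewrite {1}/inner WE// dotZr => /eqP; rewrite mulf_eq0 (negbTE (kn0 u Iu)) /=.
    by move/eqP.
  have Wn : ip W (D (nu i.+1)) c u = 0 by rewrite /inner WE// dotZl [dot _ _ _]nn mulr0.
  rewrite DW Wn addr0 in hd.
  by apply: near_eq_is_derive hd; apply: nW => s' [Is' cs']; rewrite Wnu.
split; last by exists (k i t0) => t It; exact: kc.
apply: (rotated_field_ext (X := linf (k i t0)^-1 0 W W)) => //; last exact: rotated_field_linf.
move=> c t Ac It ct; rewrite /linf scale0r addr0 WE// (kc t t0)// scalerA mulVf ?scale1r//.
exact: kn0.
Qed.

Let frenet_ind m : (m <= r)%N ->
  (forall j, (0 < j <= m)%N -> rotated_field (nu j)) /\
  (forall j, (0 < j < m)%N -> exists kappa, forall t, I t -> k j t = kappa).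
Proof.
have [/andP[r0 rn] _ fnu _ eqs] := fr.
elim: m => [_|[|m] IH mr].
- by split => -[].
- split; last by move=> [|[]].
  move=> [|[|//]] // _; apply: (rotated_field_ext (X := linf sp^-1 0 vel vel)); first exact: fnu.
    move=> c t Ac It ct; rewrite /linf scale0r addr0.
    by have [_ -> _] := eqs c t Ac It ct; rewrite speedE.
  by apply: rotated_field_linf; exact: rotated_field_velocity.
have [Knu kcst] := IH (ltnW mr).
have Km : rotated_field (nu m.+1) by apply: Knu; rewrite ltnSn.
suff [W KW WE] : exists2 W, rotated_field W & forall c t, A c -> I t -> chart_dom c (gamma t) ->
    W c t = k m.+1 t *: nu m.+2 c t.
  have [|K2 k2] := frenet_step (i := m.+1) _ KW WE; first by rewrite mr.
  split=> j /andP[j0]; rewrite leq_eqVlt => /orP[/eqP|].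
  - by move=> ->.
  - by move=> jm; apply: Knu; rewrite j0.
  - by move=> [->].
  - by move=> jm; apply: kcst; rewrite j0.
have eqm c t : A c -> I t -> chart_dom c (gamma t) -> sp^-1 *: D (nu m.+1) c t =
    (if (1 < m.+1)%N then - k m t *: nu m c t else 0) + k m.+1 t *: nu m.+2 c t.
  move=> Ac It ct; have [_ _ /(_ m.+1)] := eqs c t Ac It ct.
  by rewrite ltnS leq0n (ltnW mr) mr speedE//= => ->.
case: m => [|m] in mr IH Knu kcst Km eqm *.
  exists (linf sp^-1 0 (D (nu 1%N)) (nu 1%N)).
    by apply: rotated_field_linf => //; exact: rotated_field_covd.
  by move=> c t Ac It ct; rewrite /linf scale0r addr0 eqm//= add0r.
have [kappa kE] := kcst m.+1 (ltac:(by rewrite !ltnS leqnn)).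
(* The Frenet equation with the term in [nu m.+1] moved to the left; its coefficient is constant by
   induction, which keeps this field in the class. *)
exists (linf sp^-1 kappa (D (nu m.+2)) (nu m.+1)).
  apply: rotated_field_linf; first exact: rotated_field_covd.
  by apply: Knu; rewrite ltnS leq0n ltnW.
by move=> c t Ac It ct; rewrite /linf eqm//= kE// scaleNr addrAC addNr add0r.
Qed.

Lemma frenet_curvature_const i : (0 < i < n)%N ->
  exists kappa, forall t, I t -> k i t = kappa.
Proof.
move=> /andP[i0 i_n]; have [ir|ri] := ltnP i r.
  by have [_ +] := frenet_ind (leqnn r); apply; rewrite i0.
by exists 0 => t It; have [_ _ _ [_ +] _] := fr; apply => //; rewrite ri.
Qed.

End Uniqueness.

(** * Construction of a Frenet frame with constant curvatures *)

Section Existence.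

(* The state (nu m, nu m.+1, k m) of the Gram-Schmidt recursion
   k m.+1 *: nu m.+2 = sp^-1 *: D (nu m.+1) + k m *: nu m. *)
Fixpoint lanczos m : fieldtype R n M * fieldtype R n M * R :=
  if m is m'.+1 then
    let S := lanczos m' in
    let W := linf sp^-1 S.2 (D S.1.2) S.1.1 in
    (S.1.2, linf (Num.sqrt (b W W))^-1 0 W W, Num.sqrt (b W W))
  (* The velocity fills the place of the missing [nu 0]; its coefficient [k 0] is 0. *)
  else (vel, linf sp^-1 0 vel vel, 0).

Let E m := (lanczos m).1.2.
Let pre m := (lanczos m).1.1.
Let ka m := (lanczos m).2.
Let W m : fieldtype R n M := linf sp^-1 (ka m) (D (E m)) (pre m).

Let KE m : rotated_field (pre m) /\ rotated_field (E m).
Proof.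
elim: m => [|m [Kp Km]].
  by split; [exact: rotated_field_velocity|apply: rotated_field_linf; exact: rotated_field_velocity].
have KWm : rotated_field (W m) by apply: rotated_field_linf Kp; exact: rotated_field_covd Km.
by split; [exact: Km|exact: (rotated_field_linf _ _ KWm KWm)].
Qed.

Let KW m : rotated_field (W m).
Proof. by have [Kp Km] := KE m; exact: (rotated_field_linf _ _ (rotated_field_covd Km) Kp). Qed.

Let b_ge0 X : 0 <= b X X.
Proof.
rewrite /inner; have [-> |v0] := eqVneq (X c0 t0) 0; first by rewrite dot0l.
by have [_ _ /(_ c0 _ Ac0 (chart_imgE Ac0 ct0))[_ /(_ _ v0)/ltW]] := gm.
Qed.

Let bC X Y : b X Y = b Y X. Proof. exact: (innerC Mm gm). Qed.

Let bskew X Y : rotated_field X -> rotated_field Y -> b (D X) Y = - b X (D Y).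
Proof. by move=> KX KY; exact: rotated_field_skewE. Qed.

Let ES m Z : b (E m.+1) Z = (ka m.+1)^-1 * b (W m) Z.
Proof. by rewrite [LHS]inner_linl mul0r addr0. Qed.

Let kaS m : ka m.+1 ^+ 2 = b (W m) (W m).
Proof. exact: sqr_sqrtr. Qed.

Let bW m Z : ka m.+1 != 0 -> b (W m) Z = ka m.+1 * b (E m.+1) Z.
Proof. by move=> k0; rewrite ES mulrA divff// mul1r. Qed.

Let bDE m Z : b (D (E m)) Z = sp * (b (W m) Z - ka m * b (pre m) Z).
Proof. by rewrite [b (W m) Z]inner_linl addrK mulrA divff// mul1r. Qed.

(** Three terms suffice because D is skew. For j < m the product of D (E m) with [E j] is minus that
    of [E m] with D (E j), a combination of [E j.-1] and [E j.+1]; it vanishes unless j + 1 = m,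
    where the term in [pre m] cancels it. For j = m skewness alone gives 0. *)
Let lanczos_orthonormal m : (forall j, (0 < j <= m)%N -> ka j != 0) ->
  forall i j, (i <= m)%N -> (j <= m)%N -> b (E i) (E j) = (i == j)%:R.
Proof.
elim: m => [_ [|//] [|//] _ _|m IH k0].
  rewrite [LHS]inner_linl mul0r addr0 bC [b (E 0%N) _]inner_linl mul0r addr0 b_vel.
  by rewrite mulrA -invfM -expr2 mulVf ?sqrf_eq0 //=.
have on : forall i j, (i <= m)%N -> (j <= m)%N -> b (E i) (E j) = (i == j)%:R.
  by apply: IH => j /andP[j0 jm]; apply: k0; rewrite j0 leqW.
have kpre j : (j <= m)%N -> ka j * b (pre j) (E m) = 0.
  case: j => [|j] jm; first by rewrite [ka 0]/(0 : R) mul0r.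
  by rewrite [pre j.+1]/(E j) on ?(ltnW jm)// (ltn_eqF jm) mulr0.
have Worth j : (j <= m)%N -> b (W m) (E j) = 0.
  rewrite leq_eqVlt => /orP[/eqP ->|jm]; rewrite [LHS]inner_linl.
    rewrite kpre// addr0; have := bskew (KE m).2 (KE m).2; rewrite (bC (E m)).
    by move: (b _ _) => z e; rewrite (_ : z = 0) ?mulr0//; lra.
  rewrite (bskew (KE m).2 (KE j).2) bC bDE kpre ?(ltnW jm)// subr0.
  rewrite bW; last by apply: k0; rewrite /= ltnS ltnW.
  rewrite on// mulrN [sp^-1 * (_ * _)]mulrA mulVf// mul1r.
  case: m => [//|m] in jm on {IH k0 kpre} *.
  rewrite [pre m.+1]/(E m) on// 1?ltnW// eqSS eq_sym.
  by have [->|_] := eqVneq m j; rewrite ?mulr1 ?addNr// !mulr0 oppr0 addr0.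
have k1 : ka m.+1 != 0 by apply: k0; rewrite leqnn.
have last j : (j <= m)%N -> b (E m.+1) (E j) = 0 by move=> jm; rewrite ES Worth// mulr0.
move=> i j; rewrite leq_eqVlt => /predU1P[->|im]; rewrite leq_eqVlt => /predU1P[->|jm].
- by rewrite eqxx ES bC ES -kaS mulrA -invfM -expr2 mulVf ?sqrf_eq0.
- by rewrite last// gtn_eqF.
- by rewrite bC last// ltn_eqF.
- exact: on.
Qed.

(** Orthonormality gives the matrix of the m + 1 vectors a right inverse, so they are independent in
    dimension n. *)
Let lanczos_le m : (forall i j, (i <= m)%N -> (j <= m)%N -> b (E i) (E j) = (i == j)%:R) ->
  (m < n)%N.
Proof.
move=> on; pose B := \matrix_(i < m.+1) E i c0 t0.
have B1 : B *m (g c0 (coords c0 gamma t0) *m B^T) = 1%:M.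
  apply/matrixP => i j; rewrite [RHS]mxE.
  have := on i j (ltn_ord i) (ltn_ord j); rewrite -val_eqE/= => <-.
  rewrite /inner /dot -[E i c0 t0](rowK (fun i : 'I_m.+1 => E i c0 t0)).
  rewrite -[E j c0 t0](rowK (fun i : 'I_m.+1 => E i c0 t0)) -/B -row_mul tr_row mulmxA.
  by rewrite !mxE; apply: eq_bigr => l _; rewrite !mxE.
have : row_free B by apply/row_freeP; exists (g c0 (coords c0 gamma t0) *m B^T).
by rewrite /row_free => /eqP <-; exact: rank_leq_col.
Qed.

Lemma frenet_exists : exists (r : nat) (nu : nat -> fieldtype R n M) (k : nat -> R -> R),
  frenet A g I gamma r nu k.
Proof.
(* Otherwise the recursion would produce n + 1 orthonormal vectors in dimension n. *)
have ex : exists m, ka m.+1 == 0.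
  apply: contrapT => /forallNP h; have := @lanczos_le n; rewrite ltnn => h'.
  suff: false by []; apply: h'; apply: lanczos_orthonormal => -[//|j] _.
  by apply/negP; exact: h.
case: (ex_minnP ex) => m /eqP km min.
have k0 j : (0 < j <= m)%N -> ka j != 0.
  by case: j => [//|j] jm; apply: contraTneq jm => /eqP /min; rewrite -leqNgt.
have on := lanczos_orthonormal k0.
(* Frenet indices start at 1, so [E i] is [nu i.+1], while [ka] is already indexed like the
   curvatures. *)
exists m.+1, (fun i => E i.-1), (fun i t => if (i < m.+1)%N then ka i else 0).
have valid X Y c t : rotated_field X -> rotated_field Y -> A c -> I t -> chart_dom c (gamma t) ->
    ip X Y c t = b X Y by exact: bE.
split.
- by rewrite lanczos_le.
- by move=> c t Ac It ct; rewrite speedE.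
- by move=> i _; exact: rotated_field_along (KE _).2.
- split=> [i /andP[i0 im]|i t /andP[]]; last by rewrite leqNgt => /negbTE ->.
  by exists t0 => //; rewrite im k0// i0.
move=> c t Ac It ct; split.
- move=> [//|i] [//|j] im jm; rewrite (valid _ _ _ _ (KE _).2 (KE _).2)//.
  by rewrite on// eqSS.
- by rewrite speedE// [E _ _ _]/(linf _ _ _ _ c t) /linf scale0r addr0.
move=> [//|i] im /=; rewrite speedE//.
have Wct : W i c t = sp^-1 *: D (E i) c t + ka i *: pre i c t by [].
have -> : sp^-1 *: D (E i) c t = - ka i *: pre i c t + W i c t.
  by rewrite Wct addrCA scaleNr addNr addr0.
congr (_ + _).
  case: i im {Wct} => [|i] im /=; first by rewrite [ka 0]/(0 : R) oppr0 scale0r.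
  by have /andP[_ ->] := im.
rewrite ltnS; have [im'|mi] := ltnP i m.
  rewrite [E i.+1 c t]/(linf (ka i.+1)^-1 0 (W i) (W i) c t) /linf scale0r addr0.
  by rewrite scalerA divff ?scale1r// k0.
have -> : i = m by apply/eqP; rewrite eqn_leq mi andbT.
(* At the last index [ka m.+1 = 0] says that [W m] has norm 0 at [t0], hence at every time, and
   positivity of [g] makes it vanish. *)
apply: (inner_eq0 gm Ac ct).
by rewrite (valid _ _ _ _ (KW m) (KW m))// -kaS km expr0n.
Qed.

End Existence.

End Frenet.

End Rotation.

Theorem theorem4p8 (R : realType) (m : nat) (M : topologicalType)
    (A : set (chart R (2 * m) M)) (g phi : components R (2 * m) M)
    (I : set R) (gamma : R -> M) (xi : fieldtype R (2 * m) M) :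
  para_kahler_norden A g phi ->
  locally_symmetric A g ->
  open I -> is_interval I ->
  geodesic_T1 A g phi I gamma xi ->
  naturally_parameterized A g phi I gamma xi ->
  ~ vertical A g I gamma ->
  (exists (r : nat) (nu : nat -> fieldtype R (2 * m) M) (k : nat -> R -> R),
     frenet A g I gamma r nu k) /\
  (forall (r : nat) (nu : nat -> fieldtype R (2 * m) M) (k : nat -> R -> R),
     frenet A g I gamma r nu k ->
     forall i : nat, (1 <= i <= (2 * m).-1)%N ->
       exists kappa : R, forall t : R, I t -> k i t = kappa).
Proof.
move=> pkn symm oI iI geo _ nv.
(* Non-verticality yields a nonzero speed at one time only; constancy of the speed extends it to all
   of [I]. *)
have [c0 [t0 [Ac0 It0 ct0 s0]]] : exists c t,
    [/\ A c, I t, chart_dom c (gamma t) & speed g gamma c t != 0].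
  apply: contrapT => h; apply: nv => c t Ac It ct; apply/eqP/negPn/negP => s0.
  by apply: h; exists c, t.
split; first exact: (frenet_exists pkn symm oI iI geo Ac0 It0 ct0 s0).
move=> r nu k fr i /andP[i0 im].
apply: (frenet_curvature_const pkn symm oI iI geo Ac0 It0 ct0 fr).
(* For dimension 0 the truncated bound [(2 * m).-1] is 0, which 1 <= i excludes. *)
by rewrite i0; case: (2 * m)%N im => [|p]; [case: i i0 {fr}|].
Qed.
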